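(* Let $X$ be a proper compact subset of $[0,1]$ and let $f:X\to\mathbb{R}$ be continuous. Then for each $\beta$ with $\max\{\dim_H G_f(X),1\}\le\beta\le 2$, the function $f$ can be extended to a continuous function $\tilde f:[0,1]\to\mathbb{R}$ such that $$\dim_H G_{\tilde f}([0,1])=\beta.$$ Likewise, for each $\beta$ with $\max\{\dim_P G_f(X),1\}\le\beta\le 2$, the function $f$ can be extended to a continuous function $\tilde f:[0,1]\to\mathbb{R}$ such that $\dim_P G_{\tilde f}([0,1])=\beta$.
   Context: For a function $g$ defined on a set containing $K\subset[0,1]$, $G_g(K)=\{(x,g(x)):x\in K\}\subset\mathbb{R}^2$; $\mathbb{R}^2$ has the Euclidean metric. The Hausdorff dimension is $\dim_H F=\inf\{s\ge 0:H^s(F)=0\}$, where $H^s$ is the $s$-dimensional Hausdorff measure. The packing dimension is $\dim_P F=\inf\{s\ge 0:\mathcal{P}^s(F)=0\}$, where $\mathcal{P}^s(F)=\inf\{\sum_{i}\mathcal{P}^s_0(F_i): F\subseteq\bigcup_{i=1}^\infty F_i\}$, $\mathcal{P}^s_0(F)=\lim_{\delta\to0^+}\mathcal{P}^s_\delta(F)$, and $\mathcal{P}^s_\delta(F)$ is the supremum of $\sum_i|B_i|^s$ ($|B_i|$ the diameter of $B_i$) over countable collections $\{B_i\}$ of disjoint balls of radii at most $\delta$ with centres in $F$. *)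

(* Defs.v *)
From HB Require Import structures.
From mathcomp Require Import all_boot all_order all_algebra.
From mathcomp Require Import all_classical all_reals all_analysis.

Set Implicit Arguments.
Unset Strict Implicit.
Unset Printing Implicit Defensive.

Import Order.TTheory GRing.Theory Num.Theory.
Import numFieldNormedType.Exports.

Local Open Scope classical_set_scope.
Local Open Scope ring_scope.
Local Open Scope ereal_scope.

(* The norm of the library on R * R is the max norm, hence an explicit
   Euclidean distance. *)
Definition edist (R : realType) (p q : R * R) : R :=
  Num.sqrt ((p.1 - q.1) ^+ 2 + (p.2 - q.2) ^+ 2)%R.

Definition ecball (R : realType) (c : R * R) (r : R) : set (R * R) :=
  [set p | (edist c p <= r)%R].

(* Extended-real valued: +oo on unbounded sets, -oo on the empty set. *)
Definition diam (R : realType) (U : set (R * R)) : \bar R :=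
  ereal_sup [set (edist pq.1 pq.2)%:E | pq in U `*` U].

(* |U|^s, with the convention that the empty set contributes 0 for every s
   (also s = 0), while a one-point set contributes 0 `^ 0 = 1 when s = 0. *)
Definition diam_pow (R : realType) (s : R) (U : set (R * R)) : \bar R :=
  if U == set0 then 0 else diam U `^ s.

Definition hausdorff_premeasure (R : realType) (s d : R)
    (F : set (R * R)) : \bar R :=
  ereal_inf [set \sum_(0 <= i <oo) diam_pow s (U i) |
    U in [set U : nat -> set (R * R) |
      F `<=` \bigcup_i U i /\ forall i, diam (U i) <= d%:E]].

Definition hausdorff_measure (R : realType) (s : R)
    (F : set (R * R)) : \bar R :=
  lim (hausdorff_premeasure s d F @[d --> 0%R^'+]).

Definition hausdorff_dim (R : realType) (F : set (R * R)) : \bar R :=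
  ereal_inf [set s%:E | s in [set s : R |
    (0 <= s)%R /\ hausdorff_measure s F = 0]].

(* The index set D ranges over all sets of naturals, so that finite (and
   empty) packings are allowed along with countably infinite ones. *)
Definition is_packing (R : realType) (d : R) (F : set (R * R))
    (D : set nat) (c : nat -> R * R) (r : nat -> R) : Prop :=
  (forall i, D i -> F (c i) /\ (0 < r i <= d)%R) /\
  trivIset D (fun i => ecball (c i) (r i)).

Definition packing_premeasure (R : realType) (s d : R)
    (F : set (R * R)) : \bar R :=
  ereal_sup [set x | exists D c r, is_packing d F D c r /\
    x = \esum_(i in D) diam_pow s (ecball (c i) (r i))].

Definition packing_premeasure0 (R : realType) (s : R)
    (F : set (R * R)) : \bar R :=
  lim (packing_premeasure s d F @[d --> 0%R^'+]).

Definition packing_measure (R : realType) (s : R)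
    (F : set (R * R)) : \bar R :=
  ereal_inf [set \sum_(0 <= i <oo) packing_premeasure0 s (E i) |
    E in [set E : nat -> set (R * R) | F `<=` \bigcup_i E i]].

Definition packing_dim (R : realType) (F : set (R * R)) : \bar R :=
  ereal_inf [set s%:E | s in [set s : R |
    (0 <= s)%R /\ packing_measure s F = 0]].

Definition graph_on (R : realType) (g : R -> R) (K : set R) : set (R * R) :=
  [set (x, g x) | x in K].

(* Main.v *)
Require Import Defs.
From HB Require Import structures.
From mathcomp Require Import all_boot all_order all_algebra.
From mathcomp Require Import all_classical all_reals all_analysis.
From mathcomp Require Import ring lra zify.
Import Order.TTheory GRing.Theory Num.Theory.
Import numFieldNormedType.Exports.
Local Open Scope classical_set_scope.
Local Open Scope ring_scope.

(** One gap of X receives a piece of graph of dimension exactly beta, and the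
    rest of its complement is bridged by segments.  Both dimensions are countably
    stable ([hausdorff_dim_bigcup], [packing_dim_bigcup]) and segments have
    dimension 1, so the new graph has dimension max (dim G_f(X), 1, beta),
    which is beta.  The same extension serves both halves of the theorem:
    Hausdorff dimension never exceeds packing dimension
    ([hausdorff_dim_le_packing_dim]), so it is enough that the inserted piece
    have Hausdorff dimension at least beta and packing dimension at most beta
    ([osc_graph_exists]).

    The inserted function [osc w] is built digit by digit in base 3, following
    a word [w] made of two kinds of steps.  A refining step cuts an interval
    and its range of values in three and matches the pieces in order; an
    oscillating step cuts the interval in three and runs through the whole
    range upwards, downwards and upwards again.  After n steps, p of them
    refining, an interval of length 3^-n has its values in an interval of
    length 3^-p, and these values are uniformly distributed: a range of
    values of length l within it is taken on a set of measure 3^(p-n) l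
    ([osc_triadic]).  Lebesgue measure lifted to the graph therefore gives a
    mass of order 3^(p-2n) to a disc of radius 3^-n centred on the graph.  If p
    grows like (2 - beta) n, this is the radius to the power beta, up to
    factors of arbitrarily small exponent, and the mass distribution
    principles [hausdorff_measure_graph_neq0] and [packing_dim_graph_le] turn
    the two mass estimates [osc_mass_le] and [osc_mass_ge] into the two bounds
    on the dimension.

    Uniform distribution is only ever proved as an upper bound, in terms of
    covers by finitely many intervals ([covered]).  Such bounds pass through
    affine pieces and through uniform limits without any measurability
    question, and they imply the lower bound: in an interval of values, what
    is not taken by the two outer parts is left to the middle one. *)

Set Implicit Arguments.
Unset Strict Implicit.
Unset Printing Implicit Defensive.

(* Selects the Euclidean distance: the name also denotes an extended-valued
   distance on metric spaces. *)
Local Notation edist := Defs.edist.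

(** * Countable covers of least total weight *)

Section CoverInf.
Context {R : realType} {T : Type}.
Variables (w : set T -> \bar R) (C : set (set T)).
Hypothesis w_ge0 : forall A, (0 <= w A)%E.

(** Both the Hausdorff premeasures, with weight a power of the diameter, and
    the packing measure, with weight the packing premeasure, are of this form;
    subadditivity is thus proved once for the two of them. *)
Definition cover_inf (F : set T) : \bar R :=
  ereal_inf [set (\sum_(0 <= i <oo) w (U i))%E |
    U in [set U : nat -> set T | F `<=` \bigcup_i U i /\ forall i, C (U i)]].

Lemma cover_inf_ge0 F : (0 <= cover_inf F)%E.
Proof. by apply: le_ereal_inf_tmp => _ [U _ <-]; exact: nneseries_ge0. Qed.

Lemma le_cover_inf F G : F `<=` G -> (cover_inf F <= cover_inf G)%E.
Proof.
move=> FG; apply: ereal_inf_le_tmp => _ [U [GU CU] <-].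
by exists U => //; split=> //; exact: subset_trans FG GU.
Qed.

Lemma cover_inf_approx F (e : R) : (0 < e)%R -> (cover_inf F < +oo)%E ->
  exists U : nat -> set T, [/\ F `<=` \bigcup_i U i, forall i, C (U i) &
    (\sum_(0 <= i <oo) w (U i) <= cover_inf F + e%:E)%E].
Proof.
move=> e0 Foo; have fin : cover_inf F \is a fin_num.
  by rewrite ge0_fin_numE// cover_inf_ge0.
have [_ [U [FU CU] <-] lt_e] := lb_ereal_inf_adherent e0 fin.
by exists U; split=> //; exact: ltW.
Qed.

(** Near-optimal covers of the [F i], with errors summing up to [e], are merged
    into one sequence along a bijection between pairs and naturals. *)
Lemma cover_inf_bigcup (F : nat -> set T) :
  (cover_inf (\bigcup_i F i) <= \sum_(0 <= i <oo) cover_inf (F i))%E.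
Proof.
have [[i Fi]|/forallNP Foo] := pselect (exists i, cover_inf (F i) = +oo%E).
  rewrite (eseries_pinfty _ _ Fi) ?leey// => n _.
  by rewrite -ltNye (lt_le_trans _ (cover_inf_ge0 _)).
apply/lee_addgt0Pr => e e0.
rewrite (le_trans _ (epsilon_trick _ _ (ltW e0)))//; last first.
  by move=> n; exact: cover_inf_ge0.
have approx n : {U : nat -> set T | [/\ F n `<=` \bigcup_i U i,
    forall i, C (U i) &
    (\sum_(0 <= i <oo) w (U i) <=
      cover_inf (F n) + (e / (2 ^ n.+1)%:R)%:E)%E]}.
  apply/cid/cover_inf_approx; first by rewrite divr_gt0// ltr0n expn_gt0.
  by rewrite ltey; apply/eqP; exact: Foo.
have /card_esym/ppcard_eqP[f] := card_nat2.
pose U n := let jk := f n in sval (approx jk.1) jk.2.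
apply: (@le_trans _ _ (\sum_(0 <= i <oo) w (U i))%E).
  apply: ereal_inf_lbound; exists U => //; split=> [x [n _ Fnx]|n]; last first.
    by rewrite /U; case: (approx _) => V [].
  have [FV _ _] := svalP (approx n); have [k _ Vkx] := FV _ Fnx.
  by exists (f^-1%FUN (n, k)) => //=; rewrite /U invK ?inE.
rewrite nneseries_esumT; last by move=> n; exact: w_ge0.
rewrite -(@reindex_esum R nat (nat * nat)%type setT setT f
  (fun jk => w (sval (approx jk.1) jk.2))); last exact: (@bij _ _ _ _ f).
have -> : [set: nat * nat] = [set: nat] `*`` (fun=> [set: nat]).
  by apply/seteqP; split.
rewrite -(@esum_esum R _ _ setT (fun=> setT) (fun j k => w (sval (approx j) k)))//.
rewrite [leRHS]nneseries_esumT; last first.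
  move=> n; rewrite adde_ge0 ?cover_inf_ge0// lee_fin.
  by rewrite divr_ge0 ?(ltW e0).
apply: le_esum => n _; case: (approx n) => V [FV CV leV] /=.
by rewrite -nneseries_esumT.
Qed.

End CoverInf.

(** * The Euclidean distance and diameters *)

Section Edist.
Context {R : realType}.
Implicit Types (p q c : R * R) (U V : set (R * R)) (s t d r : R).

Lemma edist_ge0 p q : 0 <= edist p q.
Proof. exact: sqrtr_ge0. Qed.

Lemma edistC p q : edist p q = edist q p.
Proof. by rewrite /edist -(sqrrN (p.1 - _)) -(sqrrN (p.2 - _)) !opprB. Qed.

Lemma edist_fst p q : `|p.1 - q.1| <= edist p q.
Proof. by rewrite -sqrtr_sqr ler_wsqrtr// lerDl sqr_ge0. Qed.

Lemma edist_snd p q : `|p.2 - q.2| <= edist p q.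
Proof. by rewrite -sqrtr_sqr ler_wsqrtr// lerDr sqr_ge0. Qed.

Lemma edist_leD p q : edist p q <= `|p.1 - q.1| + `|p.2 - q.2|.
Proof.
rewrite -(@ler_sqr _ (edist p q)) ?nnegrE ?addr_ge0 ?edist_ge0//.
rewrite /edist sqr_sqrtr ?addr_ge0 ?sqr_ge0//.
rewrite -(real_normK (num_real (p.1 - q.1))) -(real_normK (num_real (p.2 - q.2))).
set u := `|_|; set v := `|_|.
have u0 : 0 <= u by exact: normr_ge0.
have v0 : 0 <= v by exact: normr_ge0.
by rewrite sqrrD addrAC lerDl mulrn_wge0// mulr_ge0.
Qed.

(** After squaring, this is the Cauchy-Schwarz inequality in the plane. *)
Lemma edist_triangle c p q : edist p q <= edist p c + edist c q.
Proof.
rewrite -(@ler_sqr _ (edist p q)) ?nnegrE ?addr_ge0 ?edist_ge0// sqrrD.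
rewrite /edist !sqr_sqrtr ?addr_ge0 ?sqr_ge0//.
rewrite -sqrtrM ?addr_ge0 ?sqr_ge0//.
set a := p.1 - c.1; set b := p.2 - c.2.
set a' := c.1 - q.1; set b' := c.2 - q.2.
have -> : p.1 - q.1 = a + a' by rewrite /a /a'; ring.
have -> : p.2 - q.2 = b + b' by rewrite /b /b'; ring.
have : a * a' + b * b' <= Num.sqrt ((a ^+ 2 + b ^+ 2) * (a' ^+ 2 + b' ^+ 2)).
  apply: (le_trans (ler_norm _)); rewrite -sqrtr_sqr ler_wsqrtr//.
  have := sqr_ge0 (a * b' - b * a'); nra.
rewrite -mulr_natr; nra.
Qed.

Lemma edist_le_diam U p q : U p -> U q -> ((edist p q)%:E <= diam U)%E.
Proof. by move=> Up Uq; apply: ereal_sup_ubound; exists (p, q). Qed.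

Lemma diam_leP U d : reflect (forall p q, U p -> U q -> edist p q <= d)
  (diam U <= d%:E)%E.
Proof.
apply: (iffP idP) => [Ud p q Up Uq|Ud].
  by rewrite -lee_fin (le_trans _ Ud)// edist_le_diam.
by apply: ge_ereal_sup => _ [[p q] [/= Up Uq] <-]; rewrite lee_fin; exact: Ud.
Qed.

Lemma diam_ge0 U : U !=set0 -> (0 <= diam U)%E.
Proof.
by move=> [p Up]; rewrite (le_trans _ (edist_le_diam Up Up))// lee_fin edist_ge0.
Qed.

Lemma diam_set0 d : (diam (@set0 (R * R)) <= d%:E)%E.
Proof. by apply/diam_leP. Qed.

Lemma diam_pow0 s : diam_pow s (@set0 (R * R)) = 0%E.
Proof. by rewrite /diam_pow eqxx. Qed.

Lemma diam_pow_ge0 s U : (0 <= diam_pow s U)%E.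
Proof. by rewrite /diam_pow; case: ifP => // _; exact: poweR_ge0. Qed.

Lemma diam_pow_fin s U d : U !=set0 -> (diam U <= d%:E)%E ->
  exists2 x, 0 <= x <= d & diam U = x%:E /\ diam_pow s U = (x `^ s)%:E.
Proof.
move=> U0 Ud; have dU := diam_ge0 U0.
have fU : diam U \is a fin_num by rewrite ge0_fin_numE// (le_lt_trans Ud)// ltey.
exists (fine (diam U)); first by rewrite -!lee_fin fineK// dU.
by rewrite fineK// -poweR_EFin fineK// /diam_pow ifF//; exact/negbTE/set0P.
Qed.

Lemma diam_pow_le s U d : 0 <= s -> (diam U <= d%:E)%E -> 0 <= d ->
  (diam_pow s U <= (d `^ s)%:E)%E.
Proof.
move=> s0 Ud d0; have [->|/set0P U0] := eqVneq U set0.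
  by rewrite diam_pow0 lee_fin powR_ge0.
have [x /andP[x0 xd] [_ ->]] := diam_pow_fin s U0 Ud.
by rewrite lee_fin ge0_ler_powR ?nnegrE.
Qed.

(** For s = t = 0 the points count for 1 on both sides, which is why the case
    of diameter 0 is separate. *)
Lemma diam_pow_le_exp s t U : 0 <= s -> s <= t -> (diam U <= 1%:E)%E ->
  (diam_pow t U <= diam_pow s U)%E.
Proof.
move=> s0 st U1; have [->|/set0P U0] := eqVneq U set0; first by rewrite !diam_pow0.
have [x /andP[x0 x1] [xE ->]] := diam_pow_fin t U0 U1.
have [y _ [yE ->]] := diam_pow_fin s U0 U1.
move: yE; rewrite xE => -[<-]; rewrite lee_fin.
have [->|xN0] := eqVneq x 0.
  have [t0|tN0] := eqVneq t 0; last by rewrite powR0// powR_ge0.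
  have /eqP -> : s == t by rewrite eq_le st t0.
  exact: lexx.
by apply: ger_powR => //; rewrite lt_neqAle eq_sym xN0 x0.
Qed.

Lemma diam_ecball_le c r : (diam (ecball c r) <= (2 * r)%:E)%E.
Proof.
apply/diam_leP => p q; rewrite /ecball/= => cp cq.
apply: (le_trans (edist_triangle c p q)).
by rewrite edistC mulr_natl mulr2n lerD.
Qed.

Lemma ecball_center c r : 0 <= r -> ecball c r c.
Proof. by rewrite /ecball/= /edist !subrr expr0n addr0 sqrtr0. Qed.

(** A disc has two points at distance [2 * r], the ends of its horizontal
    diameter. *)
Lemma diam_pow_ecball_ge s c r : 0 <= s -> 0 < r ->
  (((2 * r) `^ s)%:E <= diam_pow s (ecball c r))%E.
Proof.
move=> s0 r0.
have B0 : ecball c r !=set0 by exists c; exact/ecball_center/ltW.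
have [x /andP[x0 xr] [xE ->]] := diam_pow_fin s B0 (diam_ecball_le c r).
rewrite lee_fin ge0_ler_powR ?nnegrE ?mulr_ge0 ?(ltW r0)//.
rewrite -lee_fin -xE.
have side e : `|e| <= r -> ecball c r (c.1 + e, c.2).
  move=> er; rewrite /ecball/= (le_trans (edist_leD _ _))//=.
  by rewrite subrr normr0 addr0 opprD addrA subrr add0r normrN.
apply: (@le_trans _ _ (edist (c.1 + r, c.2) (c.1 + - r, c.2))%:E).
  rewrite lee_fin (le_trans _ (edist_fst _ _))//=.
  by rewrite (le_trans _ (ler_norm _))//; lra.
by apply: edist_le_diam; apply: side; rewrite ?normrN gtr0_norm.
Qed.

End Edist.

(** * Null sets and countable stability of the two dimensions *)

(** Applied to the exponents for which a set is null, this reduces every upper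
    bound on a dimension to the vanishing of measures. *)
Lemma upset_inf_leP {R : realType} (S : set R) (b : R) :
  (forall s t, S s -> s <= t -> S t) ->
  (ereal_inf [set s%:E | s in S] <= b%:E)%E <-> (forall s, b < s -> S s).
Proof.
move=> Sup; split=> [Sb s bs|Sb]; last first.
  apply/lee_addgt0Pr => e e0; apply: ereal_inf_lbound; exists (b + e) => //.
  by apply: Sb; rewrite ltrDl.
have [/= _ [t St <-]] : exists2 x, [set s%:E | s in S] x & (x < s%:E)%E.
  by apply: ereal_inf_lt; rewrite (le_lt_trans Sb)// lte_fin.
by rewrite lte_fin => /ltW; exact: Sup.
Qed.

Section Dimensions.
Context {R : realType}.
Implicit Types (F G : set (R * R)) (s t d b : R).

Lemma hausdorff_premeasureE s d F : hausdorff_premeasure s d F =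
  cover_inf (diam_pow s) [set U | (diam U <= d%:E)%E] F.
Proof. by []. Qed.

Lemma hausdorff_premeasure_ge0 s d F : (0 <= hausdorff_premeasure s d F)%E.
Proof.
by rewrite hausdorff_premeasureE; apply: cover_inf_ge0 => U; exact: diam_pow_ge0.
Qed.

Lemma le_hausdorff_premeasure s d F G : F `<=` G ->
  (hausdorff_premeasure s d F <= hausdorff_premeasure s d G)%E.
Proof. by rewrite !hausdorff_premeasureE; exact: le_cover_inf. Qed.

(** Monotonicity in the exponent needs small sets, monotonicity in the scale
    does not; the disjunction lets one lemma serve both uses. *)
Lemma hausdorff_premeasure_le s t d e F : 0 <= s -> s <= t -> d <= e ->
  t = s \/ d <= 1 ->
  (hausdorff_premeasure t e F <= hausdorff_premeasure s d F)%E.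
Proof.
move=> s0 st de std; apply: le_ereal_inf_tmp => _ [U [FU Ud] <-].
apply: ge_ereal_inf; exists (\sum_(0 <= i <oo) diam_pow t (U i))%E.
  by exists U => //; split=> // i; rewrite (le_trans (Ud i))// lee_fin.
apply: lee_nneseries => [*|i *]; first exact: diam_pow_ge0.
case: std => [->//|d1]; apply: diam_pow_le_exp => //.
by rewrite (le_trans (Ud i))// lee_fin.
Qed.

Lemma hausdorff_measureE s F : 0 <= s -> hausdorff_measure s F =
  ereal_sup [set hausdorff_premeasure s d F | d in `]0, +oo[%classic].
Proof.
move=> s0; apply/cvg_lim => //.
apply: (nonincreasing_at_right_cvge (BInfty _ false)) => // d e _ _ de.
by apply: hausdorff_premeasure_le => //; left.
Qed.

Lemma hausdorff_measure0P s F : 0 <= s ->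
  hausdorff_measure s F = 0%E <->
  (forall d, 0 < d -> (hausdorff_premeasure s d F <= 0)%E).
Proof.
move=> s0; rewrite hausdorff_measureE//; split=> [H0 d d0|H0].
  by rewrite -H0; apply: ereal_sup_ubound; exists d => //=; rewrite in_itv/= d0.
apply/eqP; rewrite eq_le; apply/andP; split.
  apply: ge_ereal_sup => _ [d /= + <-]; rewrite in_itv/= andbT; exact: H0.
apply: le_ereal_sup_tmp; exists (hausdorff_premeasure s 1 F).
  by exists 1 => //=; rewrite in_itv/= ltr01.
exact: hausdorff_premeasure_ge0.
Qed.

Lemma hausdorff_null_le s t F : 0 <= s -> s <= t ->
  hausdorff_measure s F = 0%E -> hausdorff_measure t F = 0%E.
Proof.
move=> s0 st /(hausdorff_measure0P _ s0) H0.
apply/hausdorff_measure0P => [|d d0]; first exact: le_trans s0 st.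
have m0 : 0 < Num.min 1 d by rewrite lt_min ltr01.
apply: (le_trans _ (H0 _ m0)); apply: hausdorff_premeasure_le => //.
  by rewrite ge_min lexx orbT.
by right; rewrite ge_min lexx.
Qed.

Lemma hausdorff_null_bigcup s F (E : nat -> set (R * R)) : 0 <= s ->
  F `<=` \bigcup_i E i -> (forall i, hausdorff_measure s (E i) = 0%E) ->
  hausdorff_measure s F = 0%E.
Proof.
move=> s0 FE E0; apply/hausdorff_measure0P => // d d0.
apply: (le_trans (le_hausdorff_premeasure _ _ FE)).
rewrite hausdorff_premeasureE (le_trans (cover_inf_bigcup _ (diam_pow_ge0 s) _))//.
rewrite eseries0// => i _ _; apply/eqP; rewrite eq_le.
rewrite (hausdorff_premeasure_ge0 s d (E i)) andbT.
exact: (hausdorff_measure0P _ s0).1 (E0 i) _ d0.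
Qed.

(** The condition [0 <= s] in the conclusion excludes a negative [b]. *)
Lemma hausdorff_dim_leP F b :
  (hausdorff_dim F <= b%:E)%E <->
  (forall s, b < s -> 0 <= s /\ hausdorff_measure s F = 0%E).
Proof.
apply: upset_inf_leP => s t [s0 Hs] st; split; first exact: le_trans s0 st.
exact: hausdorff_null_le Hs.
Qed.

Lemma hausdorff_dim_bigcup F (E : nat -> set (R * R)) b :
  F `<=` \bigcup_i E i -> (forall i, (hausdorff_dim (E i) <= b%:E)%E) ->
  (hausdorff_dim F <= b%:E)%E.
Proof.
move=> FE Eb; apply/hausdorff_dim_leP => s bs.
have H i : 0 <= s /\ hausdorff_measure s (E i) = 0%E.
  exact: (hausdorff_dim_leP (E i) b).1.
split; first by case: (H 0%N).
by apply: hausdorff_null_bigcup FE _ => [|i]; [case: (H 0%N)|case: (H i)].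
Qed.

Lemma le_hausdorff_dim F G : F `<=` G -> (hausdorff_dim F <= hausdorff_dim G)%E.
Proof.
move=> FG; apply: le_ereal_inf_tmp => _ [s [s0 Gs] <-].
apply: ereal_inf_lbound; exists s => //; split=> //.
by apply: (@hausdorff_null_bigcup s F (fun=> G)) => // x /FG; exists 0%N.
Qed.

Lemma packing_premeasure_ge0 s d F : (0 <= packing_premeasure s d F)%E.
Proof.
apply: le_ereal_sup_tmp; exists 0%E => //.
exists set0, (fun=> (0, 0)), (fun=> 0); split; last by rewrite esum_set0.
by split=> //; exact: trivIset_set0.
Qed.

Lemma le_packing_premeasure s t d e F G : 0 <= s -> s <= t -> d <= e ->
  t = s \/ d <= 2^-1 -> F `<=` G ->
  (packing_premeasure t d F <= packing_premeasure s e G)%E.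
Proof.
move=> s0 st de std FG; apply: ge_ereal_sup => _ [D [c [r [[cr tI] ->]]]].
apply: le_ereal_sup_tmp; exists (\esum_(i in D) diam_pow s (ecball (c i) (r i))).
  exists D, c, r; split=> //; split=> // i /cr[/FG Gc /andP[r0 rd]].
  by rewrite r0 (le_trans rd).
apply: le_esum => i Di; case: std => [->//|d2].
apply: diam_pow_le_exp => //; rewrite (le_trans (diam_ecball_le _ _))// lee_fin.
have [_ /andP[_ rd]] := cr _ Di.
by rewrite mulrC -ler_pdivlMr// div1r (le_trans rd).
Qed.

Lemma packing_premeasure0E s F : 0 <= s -> packing_premeasure0 s F =
  ereal_inf [set packing_premeasure s d F | d in `]0, +oo[%classic].
Proof.
move=> s0; apply/cvg_lim => //.
apply: (nondecreasing_at_right_cvge (BInfty _ false)) => // d e _ _ de.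
by apply: le_packing_premeasure => //; left.
Qed.

Lemma packing_premeasure0_ge0 s F : 0 <= s -> (0 <= packing_premeasure0 s F)%E.
Proof.
move=> s0; rewrite packing_premeasure0E//; apply: le_ereal_inf_tmp => _ [d _ <-].
exact: packing_premeasure_ge0.
Qed.

Lemma packing_premeasure0_le s d F : 0 <= s -> 0 < d ->
  (packing_premeasure0 s F <= packing_premeasure s d F)%E.
Proof.
move=> s0 d0; rewrite packing_premeasure0E//; apply: ereal_inf_lbound.
by exists d => //=; rewrite in_itv/= d0.
Qed.

Lemma packing_premeasure0_le_exp s t F : 0 <= s -> s <= t ->
  (packing_premeasure0 t F <= packing_premeasure0 s F)%E.
Proof.
move=> s0 st; have t0 := le_trans s0 st.
rewrite [leRHS]packing_premeasure0E//; apply: le_ereal_inf_tmp => _ [d /= + <-].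
rewrite in_itv/= andbT => d0.
have m0 : 0 < Num.min 2^-1 d by rewrite lt_min invr_gt0 ltr0n.
apply: (le_trans (packing_premeasure0_le F t0 m0)).
apply: le_packing_premeasure => //; first by rewrite ge_min lexx orbT.
by right; rewrite ge_min lexx.
Qed.

Lemma packing_measureE s F :
  packing_measure s F = cover_inf (packing_premeasure0 s) setT F.
Proof.
rewrite /packing_measure /cover_inf; congr ereal_inf; apply/seteqP.
by split=> _ [U FU <-]; exists U => //; case: FU.
Qed.

Lemma packing_measure_ge0 s F : 0 <= s -> (0 <= packing_measure s F)%E.
Proof.
move=> s0; rewrite packing_measureE; apply: cover_inf_ge0 => G.
exact: packing_premeasure0_ge0.
Qed.

Lemma packing_null_le s t F : 0 <= s -> s <= t ->
  packing_measure s F = 0%E -> packing_measure t F = 0%E.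
Proof.
move=> s0 st Fs; apply/eqP; rewrite eq_le packing_measure_ge0 ?andbT; last first.
  exact: le_trans s0 st.
rewrite -Fs; apply: le_ereal_inf_tmp => _ [U FU <-].
apply: ge_ereal_inf; exists (\sum_(0 <= i <oo) packing_premeasure0 t (U i))%E.
  by exists U.
apply: lee_nneseries => [*|i *]; last exact: packing_premeasure0_le_exp.

exact/packing_premeasure0_ge0/(le_trans s0).
Qed.

Lemma packing_null_bigcup s F (E : nat -> set (R * R)) : 0 <= s ->
  F `<=` \bigcup_i E i -> (forall i, packing_measure s (E i) = 0%E) ->
  packing_measure s F = 0%E.
Proof.
move=> s0 FE E0; apply/eqP; rewrite eq_le packing_measure_ge0 ?andbT//.
have P0 A : (0 <= packing_premeasure0 s A)%E by exact: packing_premeasure0_ge0.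
rewrite packing_measureE; apply: (le_trans (le_cover_inf _ _ FE)).
apply: (le_trans (cover_inf_bigcup setT P0 _)).
by rewrite eseries0// => i _ _; rewrite -packing_measureE.
Qed.

Lemma packing_dim_leP F b :
  (packing_dim F <= b%:E)%E <->
  (forall s, b < s -> 0 <= s /\ packing_measure s F = 0%E).
Proof.
apply: upset_inf_leP => s t [s0 Hs] st; split; first exact: le_trans s0 st.
exact: packing_null_le Hs.
Qed.

Lemma packing_dim_bigcup F (E : nat -> set (R * R)) b :
  F `<=` \bigcup_i E i -> (forall i, (packing_dim (E i) <= b%:E)%E) ->
  (packing_dim F <= b%:E)%E.
Proof.
move=> FE Eb; apply/packing_dim_leP => s bs.
have H i : 0 <= s /\ packing_measure s (E i) = 0%E.
  exact: (packing_dim_leP (E i) b).1.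
split; first by case: (H 0%N).
by apply: packing_null_bigcup FE _ => [|i]; [case: (H 0%N)|case: (H i)].
Qed.

End Dimensions.

(** * Hausdorff dimension is at most packing dimension *)

Section HausdorffLePacking.
Context {R : realType}.
Implicit Types (F G : set (R * R)) (s t d b : R).

(** Packings by discs of one common radius are enough for the comparison of
    the two measures. *)
Definition sep_family d F n (c : nat -> R * R) :=
  (forall i, (i < n)%N -> F (c i)) /\ trivIset `I_n (fun i => ecball (c i) d).

Lemma sep_family_le_packing s d F n c : 0 <= s -> 0 < d -> sep_family d F n c ->
  ((n%:R * (2 * d) `^ s)%:E <= packing_premeasure s d F)%E.
Proof.
move=> s0 d0 [cF tI]; apply: le_ereal_sup_tmp.
exists (\esum_(i in `I_n) diam_pow s (ecball (c i) d)).
  exists `I_n, c, (fun=> d); split=> //; split=> // i /cF Fc.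
  by rewrite d0 lexx.
rewrite esum_fset//=; last by move=> i _; exact: diam_pow_ge0.
rewrite -fsbig_ord mulr_natl.
have -> : ((2 * d) `^ s *+ n)%:E = (\sum_(i < n) ((2 * d) `^ s)%:E)%E.
  by rewrite sumEFin sumr_const card_ord.
by apply: lee_sum => i _; exact: diam_pow_ecball_ge.
Qed.

(** When a packing cannot be enlarged, the disc around any further point meets
    one of its discs, so that discs of twice the radius cover the set. *)
Lemma maximal_sep_family d F M : 0 < d ->
  (forall n c, sep_family d F n c -> (n%:R <= M :> R)) ->
  exists n c, sep_family d F n c /\
    forall x, F x -> exists2 i, (i < n)%N & edist (c i) x <= 2 * d.
Proof.
move=> d0 Mb.
pose P := [pred n | `[< exists c, sep_family d F n c >]].
have P0 : exists n, P n.
  exists 0%N; apply/asboolP; exists (fun=> (0, 0)).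
  by split=> // i j; rewrite /= ltn0.
have PM n : P n -> (n <= Num.truncn M)%N.
  by move=> /asboolP[c] /Mb nM; rewrite truncn_ge_nat// (le_trans (ler0n _ n)).
case: (ex_maxnP P0 PM) => n /asboolP[c [cF tI]] nmax.
exists n, c; split=> // x Fx; apply: contrapT => /forall2NP far.
(* Otherwise the disc around [x] could be added to the packing. *)
suff /nmax : P n.+1 by rewrite ltnn.
apply/asboolP; exists (fun i => if (i < n)%N then c i else x); split=> [i|].
  by case: ifP => [/cF//|].
have away i y : (i < n)%N -> ecball (c i) d y -> ecball x d y -> False.
  rewrite /ecball/= => ltin ciy xy; case: (far i) => //; apply.
  rewrite (le_trans (edist_triangle y _ _))// (edistC y) mulr_natl mulr2n.
  exact: lerD.
move=> i j /=; rewrite !ltnS => lein lejn [y []].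
case: ifPn => [ltin|]; case: ifPn => [ltjn|].
- by move=> ciy cjy; apply: tI => //; exists y.
- by move=> _ ciy xy; case: (away i y).
- by move=> _ xy ciy; case: (away j y).
- rewrite -!leqNgt => nj ni _ _; apply/eqP.
  by rewrite eqn_leq !(leq_trans _ nj, leq_trans _ ni).
Qed.

(** The doubled discs of a maximal packing form a cover; doubling the radii
    costs the factor [2 `^ s].  If the packing premeasure is finite, it bounds the
    number of discs of radius [d], hence a maximal packing exists. *)
Lemma hausdorff_premeasure_le_packing s d F : 0 <= s -> 0 < d ->
  (hausdorff_premeasure s (4 * d) F <= (2 `^ s)%:E * packing_premeasure s d F)%E.
Proof.
move=> s0 d0; have s2 : 0 < 2 `^ s :> R by rewrite powR_gt0.
have d2 : 0 < (2 * d) `^ s by rewrite powR_gt0// mulr_gt0.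
have [->|Poo] := eqVneq (packing_premeasure s d F) +oo%E.
  by rewrite gt0_muley ?lte_fin// leey.
have Pfin : packing_premeasure s d F \is a fin_num.
  by rewrite ge0_fin_numE ?packing_premeasure_ge0// ltey.
have [|n [c [nc cov]]] := @maximal_sep_family d F
    (fine (packing_premeasure s d F) / (2 * d) `^ s) d0.
  move=> n c nc; rewrite ler_pdivlMr// -lee_fin fineK//.
  exact: sep_family_le_packing nc.
apply: ge_ereal_inf.
pose U i := if (i < n)%N then ecball (c i) (2 * d) else set0.
exists (\sum_(0 <= i <oo) diam_pow s (U i))%E.
  exists U => //; split=> [x /cov[i ltin cix]|i].
    by exists i => //; rewrite /U ltin.
  rewrite /U; case: ifP => _; last exact: diam_set0.
  by rewrite (le_trans (diam_ecball_le _ _))// lee_fin; lra.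
rewrite (@nneseries_split _ _ 0 n)//; last by move=> *; exact: diam_pow_ge0.
rewrite [X in (_ + X)%E]eseries0 ?adde0; last first.
  by move=> i ni _; rewrite /U ltnNge ni/= diam_pow0.
apply: (@le_trans _ _ (\sum_(0 <= i < n) ((4 * d) `^ s)%:E)%E).
  rewrite add0n !big_mkord; apply: lee_sum => i _; rewrite /U ltn_ord.
  apply: diam_pow_le => //; last by rewrite mulr_ge0 ?(ltW d0).
  by rewrite (le_trans (diam_ecball_le _ _))// lee_fin; lra.
rewrite big_mkord sumEFin sumr_const card_ord.
have -> : (4 * d) `^ s = 2 `^ s * (2 * d) `^ s.
  by rewrite -powRM ?mulr_ge0 ?(ltW d0)//; congr (_ `^ _); ring.
rewrite -mulrnAr EFinM lee_pmul2l// -(mulr_natl ((2 * d) `^ s)).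
exact: sep_family_le_packing nc.
Qed.

Lemma hausdorff_premeasure_le_packing0 s d F : 0 <= s -> 0 < d ->
  (hausdorff_premeasure s d F <= (2 `^ s)%:E * packing_premeasure0 s F)%E.
Proof.
move=> s0 d0; have s2 : 0 < 2 `^ s :> R by rewrite powR_gt0.
rewrite -lee_pdivrMl// packing_premeasure0E//.
apply: le_ereal_inf_tmp => _ [e /= + <-]; rewrite in_itv/= andbT => e0.
rewrite lee_pdivrMl//.
have m0 : 0 < Num.min e (d / 4) by rewrite lt_min e0 divr_gt0.
apply: (le_trans (y := hausdorff_premeasure s (4 * Num.min e (d / 4)) F)).
  apply: hausdorff_premeasure_le => //; last by left.
  by rewrite mulrC -ler_pdivlMr// ge_min lexx orbT.
apply: (le_trans (hausdorff_premeasure_le_packing _ s0 m0)).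
rewrite lee_pmul2l//; apply: le_packing_premeasure => //; last by left.
by rewrite ge_min lexx.
Qed.

(** The packing premeasure is not countably subadditive, but the Hausdorff
    premeasure is: comparing the two on each piece of a countable cover yields
    the comparison with the packing measure. *)
Lemma packing_null_hausdorff_null s F : 0 <= s ->
  packing_measure s F = 0%E -> hausdorff_measure s F = 0%E.
Proof.
move=> s0 F0; apply/hausdorff_measure0P => // d d0.
have s2 : 0 < 2 `^ s :> R by rewrite powR_gt0.
rewrite -(mule0 (2 `^ s)%:E) -F0 -lee_pdivrMl//.
apply: le_ereal_inf_tmp => _ [E FE <-]; rewrite lee_pdivrMl//.
apply: (le_trans (le_hausdorff_premeasure _ _ FE)).
rewrite hausdorff_premeasureE (le_trans (cover_inf_bigcup _ (diam_pow_ge0 s) _))//.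
rewrite -nneseriesZl; last by move=> *; exact: packing_premeasure0_ge0.
apply: lee_nneseries => [*|i *]; first exact: hausdorff_premeasure_ge0.
exact: hausdorff_premeasure_le_packing0.
Qed.

Lemma hausdorff_dim_le_packing_dim F : (hausdorff_dim F <= packing_dim F)%E.
Proof.
apply: ereal_inf_le_tmp => _ [s [s0 Fs] <-]; exists s => //.
by split=> //; exact: packing_null_hausdorff_null.
Qed.

End HausdorffLePacking.

(** * Mass distribution on graphs *)

Section MassDistribution.
Context {R : realType}.
Implicit Types (g : R -> R) (s a b C : R) (K : set R).
Local Notation mu := (@lebesgue_measure R).

(** Mass distribution principle: a cover of small total weight would give
    sets of small total length covering the interval. *)
Lemma hausdorff_measure_graph_neq0 g s a b C : 0 <= s -> a < b -> 0 < C ->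
  (forall U, (diam U <= 1%:E)%E -> exists W, [/\ measurable W,
     forall x, a <= x <= b -> U (x, g x) -> W x &
     (mu W <= C%:E * diam_pow s U)%E]) ->
  hausdorff_measure s (graph_on g `[a, b]) <> 0%E.
Proof.
move=> s0 ab C0 Umass /(hausdorff_measure0P _ s0)/(_ 1 ltr01) H0.
have /eqP {}H0 : hausdorff_premeasure s 1 (graph_on g `[a, b]) == 0%E.
  by rewrite eq_le H0 hausdorff_premeasure_ge0.
(* The cover is so light that its traces on the line fill half of [b - a]. *)
pose e := (b - a) / (2 * C).
have e0 : 0 < e by rewrite divr_gt0 ?mulr_gt0 ?subr_gt0.
have := @cover_inf_approx _ _ _ [set U | (diam U <= 1%:E)%E] (diam_pow_ge0 s)
  (graph_on g `[a, b]) e e0.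
rewrite -hausdorff_premeasureE H0 ltey add0e => /(_ isT)[U [JU U1 sumU]].
have [W PW] := choice (fun i => Umass (U i) (U1 i)).
have : (mu `[a, b] <= \sum_(0 <= i <oo) mu (W i))%E.
  apply: measure_sigma_subadditive => [i||x]; first by case: (PW i).
    exact: measurable_itv.
  rewrite /= in_itv/= => xab.
  have [|i _ Uix] := JU (x, g x); first by exists x => //=; rewrite in_itv.
  by exists i => //; case: (PW i) => _ + _; apply.
rewrite lebesgue_measure_itv/= lte_fin ab -EFinB leNgt => /negP; apply.
apply: (@le_lt_trans _ _ (C%:E * e%:E)%E).
  apply: (@le_trans _ _ (C%:E * \sum_(0 <= i <oo) diam_pow s (U i))%E).
    rewrite -nneseriesZl => [|i _]; last exact: diam_pow_ge0.
    by apply: lee_nneseries => [*|i *]; [exact: measure_ge0|case: (PW i)].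
  by rewrite lee_pmul2l.
rewrite -EFinM lte_fin /e.
have -> : C * ((b - a) / (2 * C)) = (b - a) / 2 by field; rewrite gt_eqF.
lra.
Qed.

(** Dual mass distribution principle: the parts of the line seen by disjoint
    discs centred on the graph are disjoint, so their lengths, each at least
    [c * r `^ s], add up to at most [b - a].  For [t > s] the sums with exponent [t]
    are then smaller by a factor [d `^ (t - s)], which tends to 0. *)
Lemma packing_dim_graph_le g K s a b (c : R) : 0 <= s -> 0 < c -> a < b ->
  (forall x r : R, K x -> 0 < r <= 1 -> exists A : set R, [/\ measurable A,
     A `<=` `[a, b],
     forall y, A y -> ecball (x, g x) r (y, g y) &
     ((c * r `^ s)%:E <= mu A)%E]) ->
  (packing_dim (graph_on g K) <= s%:E)%E.
Proof.
move=> s0 c0 ab mass; have ba : 0 < b - a by rewrite subr_gt0.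
apply/packing_dim_leP => t st.
have t0 : 0 <= t by rewrite (le_trans s0)// ltW.
split=> //; set F := graph_on g K.
have bound d : 0 < d -> d <= 1 ->
    (packing_premeasure t d F <= (2 `^ t / c * d `^ (t - s) * (b - a))%:E)%E.
  move=> d0 d1; apply: ge_ereal_sup => _ [D [p [r [[pr tI] ->]]]].
  have PA i : exists A : set R, D i -> [/\ measurable A, A `<=` `[a, b],
     forall y, A y -> ecball (p i) (r i) (y, g y) &
     ((c * r i `^ s)%:E <= mu A)%E].
    have [Di|] := pselect (D i); last by exists set0.
    have [[x Kx <-] /andP[ri0 rid]] := pr _ Di.
    have [|A ?] := mass x (r i) Kx; last by exists A.
    by rewrite ri0 (le_trans rid).
  have {PA} [A PA] := choice PA.
  have tA : trivIset D A.
    move=> i j Di Dj [y [Aiy Ajy]]; apply: tI => //; exists (y, g y).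
    by split; [have [_ _ + _] := PA i Di|have [_ _ + _] := PA j Dj]; apply.
  have mA i : D i -> measurable (A i) by move=> /PA[].
  have esumDE (u : nat -> \bar R) : (forall i, D i -> 0 <= u i)%E ->
      (\esum_(i in D) u i = \sum_(0 <= i <oo | i \in D) u i)%E.
    move=> u0; rewrite nneseries_esum => [|i]; last by rewrite inE; exact: u0.
    by congr (esum _ _); apply/seteqP; split=> i /=; rewrite inE.
  have sumA : (\esum_(i in D) mu (A i) <= (b - a)%:E)%E.
    rewrite esumDE// -measure_bigcup//.
    apply: (@le_trans _ _ (mu `[a, b]%classic)).
      apply: le_measure; rewrite ?inE; first exact: bigcup_measurable.
        exact: measurable_itv.
      by move=> y [i Di]; have [_ + _ _] := PA i Di; apply.
    by rewrite lebesgue_measure_itv/= lte_fin ab EFinB.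
  have k0 : 0 <= 2 `^ t / c * d `^ (t - s).
    by rewrite mulr_ge0 ?powR_ge0// divr_ge0 ?powR_ge0// ltW.
  rewrite EFinM.
  apply: (@le_trans _ _ (\esum_(i in D) ((2 `^ t / c * d `^ (t - s))%:E * mu (A i)))%E).
    apply: le_esum => i Di; have [_ /andP[ri0 rid]] := pr _ Di.
    have [_ _ _ ri] := PA i Di.
    apply: (@le_trans _ _ (2 `^ t / c * d `^ (t - s) * (c * r i `^ s))%:E).
      apply: (le_trans (diam_pow_le t0 (diam_ecball_le _ _) _)).
        by rewrite mulr_ge0// ltW.
      rewrite lee_fin powRM ?(ltW ri0)//.
      have -> : 2 `^ t / c * d `^ (t - s) * (c * r i `^ s) =
          2 `^ t * (d `^ (t - s) * r i `^ s) by field; rewrite gt_eqF.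
      rewrite ler_wpM2l ?powR_ge0//.
      rewrite -{1}(subrK s t) [leLHS]powRD; last by rewrite (gt_eqF ri0) implybT.
      rewrite ler_wpM2r ?powR_ge0// ge0_ler_powR ?nnegrE ?subr_ge0 ?(ltW st)//.
        exact: ltW.
      exact: ltW.
    by rewrite EFinM lee_wpmul2l// lee_fin.
  rewrite !esumDE//; last by move=> i _; rewrite mule_ge0.
  rewrite nneseriesZl// -esumDE//.
  by rewrite lee_wpmul2l// lee_fin.
have P0 : (packing_premeasure0 t F <= 0)%E.
  apply/lee_addgt0Pr => e e0; rewrite add0e.
  have ts : 0 < t - s by rewrite subr_gt0.
  (* [d] is chosen so that the bound for scale [d] is at most [e]. *)
  pose e' := e / (b - a) / (2 `^ t / c).
  have q0 : 0 < 2 `^ t / c by rewrite divr_gt0// powR_gt0.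
  have e'0 : 0 < e' by rewrite !divr_gt0.
  pose d := Num.min 1 (e' `^ (t - s)^-1).
  have d0 : 0 < d by rewrite lt_min ltr01 powR_gt0.
  have d1 : d <= 1 by rewrite ge_min lexx.
  apply: (le_trans (packing_premeasure0_le _ t0 d0)).
  apply: (le_trans (bound d d0 d1)); rewrite lee_fin.
  rewrite -ler_pdivlMr// mulrC -ler_pdivlMr// -/e'.
  apply: (@le_trans _ _ ((e' `^ (t - s)^-1) `^ (t - s))).
    rewrite ge0_ler_powR ?nnegrE ?powR_ge0 ?(ltW d0) ?(ltW ts)//.
    by rewrite /d ge_min lexx orbT.
  rewrite -powRrM mulVf ?gt_eqF// powRr1 ?(ltW e'0)//.
apply/eqP; rewrite eq_le packing_measure_ge0// andbT.
apply: ge_ereal_inf; exists (\sum_(0 <= i <oo) packing_premeasure0 t F)%E.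
  by exists (fun=> F) => // x Fx; exists 0%N.
rewrite eseries0// => i _ _; apply/eqP.
by rewrite eq_le P0 packing_premeasure0_ge0.
Qed.

End MassDistribution.

(** * Sets covered by finitely many intervals *)

Section Covered.
Context {R : realType}.
Implicit Types (A B : set R) (c d m q : R) (s : seq (R * R)).
Local Notation mu := (@lebesgue_measure R).

(** An upper bound for the outer Lebesgue content.  The explicit finite list of
    intervals makes its behaviour under affine maps immediate. *)
Definition covered A c := exists s, [/\ all (fun u => u.1 <= u.2) s,
  forall x, A x -> has (fun u => u.1 <= x <= u.2) s &
  \sum_(u <- s) (u.2 - u.1) <= c].

Lemma covered_sub A B c d : A `<=` B -> c <= d -> covered B c -> covered A d.
Proof.
move=> AB cd [s [sle sB sc]]; exists s; split=> // [x /AB/sB//|].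
exact: le_trans cd.
Qed.

Lemma covered_itv a b : a <= b -> covered [set x | a <= x <= b] (b - a).
Proof.
move=> ab; exists [:: (a, b)]; split=> [|x /= xab|]; rewrite ?big_seq1//=.
  by rewrite ab.
by rewrite xab.
Qed.

Lemma coveredU A B c d : covered A c -> covered B d -> covered (A `|` B) (c + d).
Proof.
move=> [s [sle sA sc]] [t [tle tB td]]; exists (s ++ t).
split; rewrite ?all_cat ?sle ?big_cat ?lerD//= => x [/sA|/tB];
  by rewrite has_cat => ->; rewrite ?orbT.
Qed.

Lemma covered_opp A c : covered A c -> covered [set x | A (- x)] c.
Proof.
move=> [s [/allP sle sA sc]]; exists [seq (- u.2, - u.1) | u <- s]; split.
- by apply/allP => _ /mapP[u us ->] /=; rewrite lerN2; exact: sle.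
- move=> x /= /sA /hasP[u us ux]; apply/hasP; exists (- u.2, - u.1).
    exact: (map_f (fun u => (- u.2, - u.1))).
  by rewrite /= lerNl andbC lerNr.
- rewrite big_map (le_trans _ sc)// le_eqVlt; apply/orP; left; apply/eqP.
  by apply: eq_bigr => u _ /=; ring.
Qed.

Lemma covered_affine A c m q : 0 < m -> covered A c ->
  covered [set x | A (m * x + q)] (c / m).
Proof.
move=> m0 [s [/allP sle sA sc]].
exists [seq ((u.1 - q) / m, (u.2 - q) / m) | u <- s]; split.
- apply/allP => _ /mapP[u us ->] /=; rewrite ler_pM2r ?invr_gt0// lerD2r.
  exact: sle.
- move=> x /= /sA /hasP[u us /andP[ux xu]]; apply/hasP.
  exists ((u.1 - q) / m, (u.2 - q) / m).
    exact: (map_f (fun u => ((u.1 - q) / m, (u.2 - q) / m))).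
  by rewrite /= ler_pdivrMr// ler_pdivlMr// mulrC lerBlDr ux lerBrDr xu.
- rewrite big_map ler_pdivlMr// (le_trans _ sc)// mulr_suml.
  rewrite le_eqVlt; apply/orP; left; apply/eqP.
  by apply: eq_bigr => u _ /=; field; rewrite gt_eqF.
Qed.

Lemma covered_measurable A c : covered A c ->
  exists W, [/\ measurable W, A `<=` W & (mu W <= c%:E)%E].
Proof.
move=> [s [sle sA sc]].
suff [W [mW sW muW]] : exists W : set R, [/\ measurable W,
    forall x, has (fun u => u.1 <= x <= u.2) s -> W x &
    (mu W <= (\sum_(u <- s) (u.2 - u.1))%:E)%E].
  exists W; split=> // [x /sA/sW//|]; apply: (le_trans muW).
  by rewrite lee_fin.
elim: s sle {A sA c sc} => [_|u s IH /= /andP[u12 /IH[W [mW sW muW]]]].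
  by exists set0; split; rewrite ?big_nil ?measure0.
exists (`[u.1, u.2] `|` W); split.
- by apply: measurableU => //; exact: measurable_itv.
- by move=> x /orP[xu|/sW]; [left; rewrite /= in_itv|right].
- have m12 : measurable `[u.1, u.2] by exact: measurable_itv.
  rewrite big_cons EFinD; apply: (le_trans (measureU2 mu m12 mW)).
  rewrite leeD//.
  rewrite [leLHS](lebesgue_measure_itv `[u.1, u.2])/= lte_fin EFinB; case: ifP => // _.
  by rewrite -EFinB lee_fin subr_ge0.
Qed.

End Covered.

(** * Oscillating functions with uniformly distributed values *)

Section Oscillation.
Context {R : realType}.
Implicit Types (w : nat -> bool) (x y a b t : R) (k i j : int) (n N m : nat).

(** Two values [a <= b] cut out of the interval from [c] to [c + 1] a part of
    length [clip c b - clip c a]. *)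
Definition clip (c t : R) : R := Num.max c (Num.min (c + 1) t).

Lemma clipP c t : [\/ t <= c /\ clip c t = c, c <= t <= c + 1 /\ clip c t = t |
  c + 1 <= t /\ clip c t = c + 1].
Proof.
rewrite /clip; case: (leP (c + 1) t) => [ct|tc].
  by constructor 3; split=> //; rewrite max_r// lerDl.
case: (leP t c) => [tc'|ct]; first by constructor 1.
by constructor 2; rewrite !ltW.
Qed.

(** Cutting a unit interval in thirds and rescaling each by 3: the lengths found
    in the three parts add up. *)
Lemma clip_split c t :
  clip (3 * c) (3 * t) + clip (3 * c + 1) (3 * t) + clip (3 * c + 2) (3 * t) =
  3 * clip c t + 6 * c + 3.
Proof.
by have [[? ->]|[/andP[? ?] ->]|[? ->]] := clipP (3 * c) (3 * t);
  have [[? ->]|[/andP[? ?] ->]|[? ->]] := clipP (3 * c + 1) (3 * t);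
  have [[? ->]|[/andP[? ?] ->]|[? ->]] := clipP (3 * c + 2) (3 * t);
  have [[? ->]|[/andP[? ?] ->]|[? ->]] := clipP c t; lra.
Qed.

(** Between two consecutive integers the graph goes up, down and up again with
    slopes 3, -3 and 3; integers are fixed. *)
Definition zigzag x : R :=
  let k := (Num.floor x)%:~R in let t := x - k in
  k + (if t <= 3^-1 then 3 * t else if t <= 2 / 3 then 2 - 3 * t else 3 * t - 2).

Lemma zigzag_near k x : k%:~R <= x <= k%:~R + 1 ->
  [/\ x <= k%:~R + 3^-1 -> zigzag x = 3 * x - 2 * k%:~R,
      k%:~R + 3^-1 <= x <= k%:~R + 2 / 3 -> zigzag x = 4 * k%:~R + 2 - 3 * x &
      k%:~R + 2 / 3 <= x -> zigzag x = 3 * x - 2 * k%:~R - 2].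
Proof.
move=> /andP[kx]; rewrite le_eqVlt => /predU1P[->|xk].
  have -> : zigzag (k%:~R + 1) = k%:~R + 1.
    rewrite /zigzag -[1]/(1%:~R) -intrD floorK ?intr_int//.
    by rewrite subrr mulr0 invr_ge0 ler0n addr0.
  by split=> [||]; lra.
rewrite /zigzag (@floor_def _ x k); last by rewrite kx intrD.
have [h1|h1] := leP (x - k%:~R) 3^-1; first by split=> *; lra.
by have [h2|h2] := leP (x - k%:~R) (2 / 3); split=> *; lra.
Qed.

(** The first letter of the word is the outermost step.  Precomposition with
    [zigzag] makes an oscillating step; conjugation with multiplication by 3 makes
    a refining step, since functions preserving each interval between consecutive
    integers then preserve each interval between consecutive multiples of 1/3. *)
Fixpoint osc_approx n w x : R :=
  if n is n'.+1 then
    if w 0%N then osc_approx n' (w \o succn) (3 * x) / 3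
    else osc_approx n' (w \o succn) (zigzag x)
  else x.

(** Each refining step divides the range of values by 3. *)
Definition depth w n : nat := (\sum_(i < n) w i)%N.

Lemma depthS w n : depth w n.+1 = (w 0%N + depth (w \o succn) n)%N.
Proof. by rewrite /depth big_ord_recl. Qed.

(** A refining step needs the induction hypothesis on the three unit intervals
    that make up [3k, 3k + 3]. *)
Lemma osc_approx_unit n w k x : k%:~R <= x <= k%:~R + 1 ->
  k%:~R <= osc_approx n w x <= k%:~R + 1.
Proof.
elim: n w k x => [//|n IH] w k x /andP[kx xk] /=; case: ifP => _.
  have three j r : (j%:~R = r :> R) -> 0 <= r <= 2 ->
      3 * k%:~R + r <= 3 * x <= 3 * k%:~R + r + 1 ->
      k%:~R <= osc_approx n (w \o succn) (3 * x) / 3 <= k%:~R + 1.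
    move=> jr r02; have -> : 3 * k%:~R + r = (3 * k + j)%:~R by rewrite intrD intrM jr.
    move=> /(IH (w \o succn)); rewrite intrD intrM jr.
    by move: (osc_approx _ _ _) => y /andP[? ?]; apply/andP; split; lra.
  have [h1|h1] := leP (3 * x) (3 * k%:~R + 1).
    by apply: (three 0 0) => //; lra.
  have [h2|h2] := leP (3 * x) (3 * k%:~R + 2).
    by apply: (three 1 1) => //; lra.
  by apply: (three 2 2) => //; lra.
apply: IH; have [|z0 z1 z2] := @zigzag_near k x; first by rewrite kx.
have [h1|h1] := leP x (k%:~R + 3^-1); first by rewrite z0//; lra.
by have [h2|h2] := leP x (k%:~R + 2 / 3); [rewrite z1; lra|rewrite z2; lra].
Qed.

(** An approximation and all later ones send a point into one common interval of
    length 3^-depth. *)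
Lemma osc_approx_cauchy m n w x :
  `|osc_approx (n + m) w x - osc_approx n w x| <= 3^-1 ^+ depth w n.
Proof.
elim: n w x => [|n IH] w x.
  rewrite /depth big_ord0 expr0 add0n /=.
  have xk : (Num.floor x)%:~R <= x <= (Num.floor x)%:~R + 1.
    by have := floor_itv x; rewrite intrD => /andP[-> /ltW].
  have := osc_approx_unit m w xk; move: xk.
  move: (osc_approx _ _ _) => y /andP[? ?] /andP[? ?].
  by rewrite ler_norml; lra.
rewrite addSn depthS /=; case: ifP => _; last exact: IH.
by rewrite exprS -mulrBl normrM mulrC (ger0_norm (_ : 0 <= 3^-1))// ler_wpM2l.
Qed.

(** Uniform distribution on a unit interval.  Each third contributes: in a
    refining step the three parts of the range share the values, and the lengths
    add up by [clip_split]; in an oscillating step each third takes all the values,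
    three times faster. *)
Lemma osc_approx_occupation n w k a b : a <= b ->
  covered [set x | k%:~R <= x <= k%:~R + 1 /\ a <= osc_approx n w x <= b]
    (clip k%:~R b - clip k%:~R a).
Proof.
elim: n w k a b => [|n IH] w k a b ab.
  have cab : clip (k%:~R) a <= clip (k%:~R) b.
    by have [[? ->]|[/andP[? ?] ->]|[? ->]] := clipP k%:~R a;
       have [[? ->]|[/andP[? ?] ->]|[? ->]] := clipP k%:~R b; lra.
  apply: covered_sub (covered_itv cab) => // x /= [/andP[kx xk] /andP[ax xb]].
  by have [[? ->]|[/andP[? ?] ->]|[? ->]] := clipP k%:~R a;
     have [[? ->]|[/andP[? ?] ->]|[? ->]] := clipP k%:~R b; lra.
have r3 : 0 < 3 :> R by [].
rewrite /=; case: (w 0%N).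
  have ab3 : 3 * a <= 3 * b by rewrite ler_pM2l.
  have third (j : int) := covered_affine 0 r3 (IH (w \o succn) j (3 * a) (3 * b) ab3).
  have {}third j : covered [set x | j%:~R <= 3 * x <= j%:~R + 1 /\
      a <= osc_approx n (w \o succn) (3 * x) / 3 <= b]
      ((clip j%:~R (3 * b) - clip j%:~R (3 * a)) / 3).
    apply: covered_sub (third j) => //.
    move=> x /=; rewrite addr0; move: (osc_approx _ _ _) => y [? /andP[? ?]].
    by split=> //; lra.
  apply: covered_sub (coveredU (coveredU (third (3 * k)) (third (3 * k + 1)))
    (third (3 * k + 2))).
    move=> x /= [/andP[kx xk] xab].
    have [h1|h1] := leP (3 * x) (3 * k%:~R + 1).
      by left; left; split=> //; rewrite intrM; lra.
    have [h2|h2] := leP (3 * x) (3 * k%:~R + 2).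
      by left; right; split=> //; rewrite intrD intrM; lra.
    by right; split=> //; rewrite intrD intrM; lra.
  have := clip_split k%:~R a; have := clip_split k%:~R b.
  by rewrite !intrD !intrM; lra.
have up (q : R) := covered_affine q r3 (IH (w \o succn) k a b ab).
have down (q : R) := covered_opp (up q).
apply: covered_sub (coveredU (coveredU (up (- (2 * k%:~R)))
  (down (4 * k%:~R + 2))) (up (- (2 * k%:~R) - 2))); last by lra.
move=> x /= [/andP[kx xk]].
have [|z0 z1 z2] := @zigzag_near k x; first by rewrite kx.
have [h1|h1] := leP x (k%:~R + 3^-1).
  rewrite z0// => xab; left; left; split=> //; lra.
have [h2|h2] := leP x (k%:~R + 2 / 3).
  rewrite z1; last by lra.
  have -> : 3 * - x + (4 * k%:~R + 2) = 4 * k%:~R + 2 - 3 * x by ring.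
  by move=> xab; left; right; split=> //; lra.
rewrite z2; last by lra.
have -> : 3 * x - 2 * k%:~R - 2 = 3 * x + (- (2 * k%:~R) - 2) by ring.
by move=> xab; right; split=> //; lra.
Qed.

(** Written without division, so that multiplying the argument by 3 passes from
    one generation of triadic intervals to the next. *)
Definition triadic n i : set R := [set x | i%:~R <= 3 ^+ n * x <= i%:~R + 1].

(** On a triadic interval of generation [n.+1] the map [zigzag] is affine of slope
    3 or -3, onto one of generation [n].  The second clause pulls covers back. *)
Lemma zigzag_triadic n i : exists i',
  (forall x, triadic n.+1 i x -> triadic n i' (zigzag x)) /\
  (forall A c, covered A c ->
    covered [set x | triadic n.+1 i x /\ A (zigzag x)] (c / 3)).
Proof.
have r3 : 0 < 3 :> R by [].
pose P : R := 3 ^+ n; have P0 : 0 < P by rewrite exprn_gt0.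
have PE : (3 ^+ n)%:~R = P by rewrite rmorphXn.
pose j := (i %/ 3 ^+ n)%Z; pose k := (j %/ 3)%Z; pose d := (j %% 3)%Z.
have jE : j%:~R = 3 * k%:~R + d%:~R :> R.
  by rewrite {1}(divz_eq j 3) intrD intrM mulrC.
have [jP Pj] : j%:~R * P <= i%:~R /\ i%:~R + 1 <= (j%:~R + 1) * P.
  have Pn0 : (3 ^+ n : int) != 0 by rewrite expf_neq0.
  have P0' : 0 < (3 ^+ n : int) by rewrite exprn_gt0.
  rewrite -PE -(intrD _ j 1) -(intrD _ i 1) -!intrM !ler_int; split.
    by rewrite lez_floor.
  by rewrite lezD1 ltz_ceil.
have x3 x : triadic n.+1 i x -> [/\ i%:~R <= 3 * (P * x) <= i%:~R + 1 &
    j%:~R <= 3 * x <= j%:~R + 1].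
  rewrite /triadic/= exprS -/P -mulrA => /andP[ix xi]; rewrite ix xi; split=> //.
  have e : 3 * x * P = 3 * (P * x) by ring.
  by rewrite -(ler_pM2r P0) -(ler_pM2r P0 (3 * x)) e; apply/andP; split; lra.
have scale (y : R) : P * (3 * y) = 3 * (P * y) by ring.
have d012 : [\/ d = 0, d = 1 | d = 2].
  have : 0 <= d by apply: modz_ge0.
  have : d < 3 by apply: ltz_pmod.
  by case: d {jE} => [[|[|[|//]]]|//] _ _; [constructor 1|constructor 2|constructor 3].
have up_affine (i' : int) (q : R) : i'%:~R = i%:~R + q * P ->
    (forall x, triadic n.+1 i x -> zigzag x = 3 * x + q) ->
    (forall x, triadic n.+1 i x -> triadic n i' (zigzag x)) /\
    (forall A c, covered A c ->
      covered [set x | triadic n.+1 i x /\ A (zigzag x)] (c / 3)).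
  move=> i'E zE; split=> [x xi|A c Ac].
    have [/andP[? ?] _] := x3 x xi.
    rewrite zE// /triadic/= -/P mulrDr scale i'E (mulrC P q).
    by apply/andP; split; lra.
  apply: covered_sub (covered_affine q r3 Ac) => // x [xi] /=.
  by rewrite zE.
have zz := zigzag_near (k := k).
case: d012 => dE; rewrite dE in jE.
- exists (i - 2 * k * 3 ^+ n); apply: (up_affine _ (- (2 * k%:~R))).
    by rewrite intrB !intrM PE; ring.
  move=> x xi; have [_ /andP[? ?]] := x3 x xi.
  have [|z0 _ _] := zz x; first by apply/andP; split; lra.
  by rewrite z0; lra.
- exists ((4 * k + 2) * 3 ^+ n - i - 1).
  have zE x : triadic n.+1 i x -> zigzag x = 4 * k%:~R + 2 - 3 * x.
    move=> xi; have [_ /andP[? ?]] := x3 x xi.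
    have [|_ z1 _] := zz x; first by apply/andP; split; lra.
    by rewrite z1//; lra.
  split=> [x xi|A c Ac].
    have [/andP[? ?] _] := x3 x xi.
    rewrite zE// /triadic/= -/P !intrB intrM intrD intrM PE mulrBr scale.
    by rewrite (mulrC P (_ + _)); apply/andP; split; lra.
  apply: covered_sub (covered_opp (covered_affine (4 * k%:~R + 2) r3 Ac)) => //.
  by move=> x [xi] /=; rewrite zE// mulrN addrC.
- exists (i - (2 * k + 2) * 3 ^+ n); apply: (up_affine _ (- (2 * k%:~R + 2))).
    by rewrite intrB !intrM PE intrD intrM; ring.
  move=> x xi; have [_ /andP[? ?]] := x3 x xi.
  have [|_ _ z2] := zz x; first by apply/andP; split; lra.
  by rewrite z2; lra.
Qed.

(** By [osc_approx_cauchy] the lower ends of the intervals of radius 3^-depth around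
    the approximations lie below all their upper ends, so the supremum of the lower
    ends is within 3^-depth of each approximation.  It is therefore
    the limit as soon as the depth is unbounded. *)
Definition osc w x : R :=
  sup [set osc_approx n w x - 3^-1 ^+ depth w n | n in [set: nat]].

Lemma osc_near n w x : `|osc w x - osc_approx n w x| <= 3^-1 ^+ depth w n.
Proof.
set S := [set osc_approx n w x - 3^-1 ^+ depth w n | n in [set: nat]].
have r n' : 0 <= 3^-1 ^+ depth w n' :> R by rewrite exprn_ge0.
have ub m : ubound S (osc_approx m w x + 3^-1 ^+ depth w m).
  move=> _ [l _ <-]; have rl := r l; have rm := r m.
  have [lm|/ltnW ml] := leqP l m.
    have := osc_approx_cauchy (m - l) l w x; rewrite subnKC//.
    by rewrite ler_norml => /andP[? ?]; lra.
  have := osc_approx_cauchy (l - m) m w x; rewrite subnKC//.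
  by rewrite ler_norml => /andP[? ?]; lra.
have supS : has_sup S.
  split; last by exists (osc_approx 0 w x + 3^-1 ^+ depth w 0); exact: ub.
  by exists (osc_approx 0 w x - 3^-1 ^+ depth w 0); exists 0%N.
have lo : osc_approx n w x - 3^-1 ^+ depth w n <= osc w x.
  by apply: ub_le_sup; [case: supS|exists n].
have hi : osc w x <= osc_approx n w x + 3^-1 ^+ depth w n.
  by apply: ge_sup; [case: supS|exact: ub].
by rewrite ler_norml; lra.
Qed.

(** Unrolling [n] letters of the word turns the restriction to a triadic interval
    into a rescaled approximation on a unit interval, to which
    [osc_approx_unit] and [osc_approx_occupation] apply. *)
Lemma osc_approx_triadic n w i : exists k, forall N,
  (forall x, triadic n i x ->
    k%:~R <= 3 ^+ depth w n * osc_approx (n + N) w x <= k%:~R + 1) /\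
  (forall a b, a <= b ->
    covered [set x | triadic n i x /\ a <= osc_approx (n + N) w x <= b]
      (3 ^+ depth w n * (b - a) / 3 ^+ n)).
Proof.
have r3 : 0 < 3 :> R by [].
elim: n w i => [|n IH] w i.
  exists i => N; rewrite add0n /depth big_ord0 expr0; split=> [x|a b ab].
    by rewrite /triadic/= !mul1r; exact: osc_approx_unit.
  apply: covered_sub (osc_approx_occupation N w i ab) => [x|].
    by rewrite /triadic/= expr0 mul1r.
  rewrite mul1r divr1.
  by have [[? ->]|[/andP[? ?] ->]|[? ->]] := clipP (i%:~R : R) a;
     have [[? ->]|[/andP[? ?] ->]|[? ->]] := clipP (i%:~R : R) b; lra.
have P0 : 3 ^+ n != 0 :> R by rewrite expf_neq0.
rewrite depthS; case w0: (w 0%N).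
  have [k Hk] := IH (w \o succn) i; exists k => N.
  have {Hk} [Hk Hc] := Hk N; rewrite addSn /= w0.
  have triadicS x : triadic n.+1 i x = triadic n i (3 * x).
    by rewrite /triadic/= exprSr mulrA.
  split=> [x|a b ab].
    rewrite triadicS => /Hk; rewrite add1n exprSr.
    by rewrite -mulrA (mulrC 3 (_ / 3)) divfK ?gt_eqF.
  have ab3 : 3 * a <= 3 * b by rewrite ler_pM2l.
  apply: covered_sub (covered_affine 0 r3 (Hc _ _ ab3)).
    move=> x; rewrite /= addr0 triadicS; move: (osc_approx _ _ _) => y [? /andP[? ?]].
    by split=> //; lra.
  rewrite add1n !exprS le_eqVlt; apply/orP; left; apply/eqP; field.
  by rewrite P0.
have [i' [zi zc]] := zigzag_triadic n i.
have [k Hk] := IH (w \o succn) i'; exists k => N.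
have {Hk} [Hk Hc] := Hk N; rewrite addSn /= w0 add0n.
split=> [x /zi/Hk//|a b ab].
apply: covered_sub (zc _ _ (Hc a b ab)) => [x /= [xi xab]|].
  by split=> //; split=> //; exact: zi.
by rewrite exprS le_eqVlt; apply/orP; left; apply/eqP; field; rewrite P0.
Qed.

End Oscillation.

(** * Prescribing the density of refining steps *)

Section Climb.
Context {R : realType}.
Implicit Types (a e : R) (n : nat).

(** The greedy sequence of increments 0 and 1 that keeps above [a * n] and above
    the square root of [n], up to 1.  The square root, negligible against [n],
    is there for [a = 0]: the depth must still tend to infinity, or the limit
    function would not be continuous. *)
Fixpoint climb a n : nat :=
  if n is m.+1 then
    ((((climb a m)%:R < a * m%:R)%R || (climb a m ^ 2 < m)) + climb a m)%N
  else 0%N.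

Definition climb_word a n : bool :=
  ((climb a n)%:R < a * n%:R) || (climb a n ^ 2 < n)%N.

Lemma depth_climb a n : depth (climb_word a) n = climb a n.
Proof.
elim: n => [|n IH]; first by rewrite /depth big_ord0.
by rewrite /depth big_ord_recr/= -/(depth _ n) IH addnC.
Qed.

Lemma climb_ge a n : 0 <= a <= 1 -> a * n%:R - 1 <= (climb a n)%:R.
Proof.
move=> /andP[a0 a1]; elim: n => [|n IH]; first by rewrite mulr0 sub0r lerN10.
rewrite /= natrD -(natr1 n) mulrDr mulr1.
have [h|h] := ltP (climb a n)%:R (a * n%:R) => /=; first by lra.
have : 0 <= ((climb a n ^ 2 < n)%N : nat)%:R :> R by [].
lra.
Qed.

Lemma climb_sqr a n : (n <= climb a n ^ 2 + 1)%N.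
Proof.
elim: n => [//|n IH] /=.
case: (ltnP (climb a n ^ 2) n) => h; rewrite ?orbT ?orbF.
  by rewrite (leq_trans (_ : _ <= climb a n ^ 2 + 2))%N//; nia.
case: (_ < _) => /=; nia.
Qed.

(** An increment occurs only below [a * n] or below the square root of [n], which
    is at most [e * n + e^-1]. *)
Lemma climb_le a e n : 0 <= a -> 0 < e ->
  (climb a n)%:R <= (a + e) * n%:R + (e^-1 + 1).
Proof.
move=> a0 e0; have ei : 0 < e^-1 by rewrite invr_gt0.
elim: n => [|n IH] /=; first by rewrite mulr0; lra.
have an : 0 <= a * n%:R by rewrite mulr_ge0.
have en : 0 <= e * n%:R by rewrite mulr_ge0// ltW.
rewrite natrD -(natr1 n).
have [h|h] := ltP (climb a n)%:R (a * n%:R) => /=; first by lra.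
have [h'|h'] := ltnP (climb a n ^ 2) n => /=; last by lra.
suff : (climb a n)%:R <= e * n%:R + e^-1 by lra.
have [pe|ep] := leP (climb a n)%:R e^-1; first by lra.
have : (climb a n)%:R ^+ 2 <= n%:R :> R by rewrite -natrX ler_nat ltnW.
move: ep; move: (climb a n)%:R => p ep pn.
have : 1 <= e * p by rewrite -(mulfV (lt0r_neq0 e0)) ler_pM2l// ltW.
have p0 : 0 < p by rewrite (lt_trans ei).
move=> ep1; have : p <= e * p * p by rewrite -[leLHS]mul1r ler_pM2r.
have : e * (p ^+ 2) <= e * n%:R by rewrite ler_pM2l.
rewrite expr2 mulrA; lra.
Qed.

End Climb.

(** * Uniform distribution for the limit function *)

Section OscillationGraph.
Context {R : realType}.
Implicit Types (w : nat -> bool) (x y a b e : R) (k i j : int) (n N m : nat).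
Local Notation mu := (@lebesgue_measure R).

Definition unbounded_depth w := forall q, exists n, (q <= depth w n)%N.

Lemma depth_le w n : (depth w n <= n)%N.
Proof.
rewrite /depth -[X in (_ <= X)%N]card_ord -sum1_card; apply: leq_sum => i _.
exact: leq_b1.
Qed.

Lemma depth_mono w m n : (m <= n)%N -> (depth w m <= depth w n)%N.
Proof.
move=> /subnKC <-; elim: (n - m)%N => [|l IH]; first by rewrite addn0.
by rewrite addnS /depth big_ord_recr/= (leq_trans IH)// leq_addr.
Qed.

Lemma depth_small w e : unbounded_depth w -> 0 < e ->
  exists n, forall m, (n <= m)%N -> 3^-1 ^+ depth w m <= e.
Proof.
move=> wu e0; have [n qn] := wu (Num.truncn e^-1).+1.
exists n => m nm; rewrite exprVn -[leRHS]invrK lef_pV2 ?posrE ?invr_gt0 ?exprn_gt0//.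
apply: (le_trans (ltW (truncnS_gt _))); rewrite -natrX ler_nat.
apply: (leq_trans qn); apply: (leq_trans (depth_mono w nm)).
exact/ltnW/ltn_expl.
Qed.

(** Passing from approximations to the limit widens the range of values by
    arbitrarily little, whence the error [e]. *)
Lemma osc_triadic w n i : unbounded_depth w -> exists k,
  (forall x, triadic n i x -> k%:~R <= 3 ^+ depth w n * osc w x <= k%:~R + 1) /\
  (forall a b e, a <= b -> 0 < e ->
    covered [set x | triadic n i x /\ a <= osc w x <= b]
      (3 ^+ depth w n * (b - a) / 3 ^+ n + e)).
Proof.
move=> wu; have [k Hk] := osc_approx_triadic (R := R) n w i; exists k.
set P : R := 3 ^+ depth w n; have P0 : 0 < P by rewrite exprn_gt0.
have near e : 0 < e -> exists N, forall x,
    `|osc w x - osc_approx (n + N) w x| <= e.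
  move=> e0; have [M HM] := depth_small wu e0; exists M => x.
  by apply: (le_trans (osc_near _ _ _)); apply: HM; rewrite leq_addl.
split=> [x xi|a b e ab e0].
  have close e : 0 < e -> k%:~R - e <= P * osc w x <= k%:~R + 1 + e.
    move=> e0; have [|N HN] := near (e / P); first by rewrite divr_gt0.
    have [/(_ x xi) + _] := Hk N; have := HN x.
    rewrite ler_distl lerBlDr -(ler_pM2l P0) -(ler_pM2l P0 (osc w x)).
    rewrite !mulrDr (mulrC P (e / P)) divfK ?gt_eqF// -/P.
    by move=> /andP[? ?] /andP[? ?]; apply/andP; split; lra.
  apply/andP; split.
    by apply/ler_addgt0Pr => e /close/andP[? _]; lra.
  by apply/ler_addgt0Pr => e /close/andP[_ ?]; lra.
have T0 : 0 < (3 ^+ n : R) by rewrite exprn_gt0.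
(* Widening the range by [d] on both sides costs exactly [e]. *)
pose d := e * 3 ^+ n / P / 2.
have d0 : 0 < d by rewrite !divr_gt0// mulr_gt0.
have [N HN] := near d d0.
have [_ /(_ (a - d) (b + d))] := Hk N; rewrite -/P => Hc.
apply: covered_sub (Hc _); last by lra.
  move=> x [xi /andP[ax xb]]; split=> //.
  by have := HN x; rewrite ler_distl => /andP[? ?]; apply/andP; split; lra.
rewrite le_eqVlt; apply/orP; left; apply/eqP; rewrite /d; field.
by rewrite !gt_eqF.
Qed.

End OscillationGraph.

(** * Continuity and mass estimates for the oscillating graph *)

Section OscGraphDim.
Context {R : realType}.
Implicit Types (w : nat -> bool) (x y a b e r s t K : R) (k i j : int) (n N m : nat).
Local Notation mu := (@lebesgue_measure R).

Lemma triadicE n i :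
  triadic n i = `[i%:~R / 3 ^+ n, (i%:~R + 1) / 3 ^+ n]%classic :> set R.
Proof.
have T0 : 0 < (3 ^+ n : R) by rewrite exprn_gt0.
apply/seteqP; split=> x /=; rewrite in_itv/= ler_pdivrMr// ler_pdivlMr//;
  by rewrite mulrC.
Qed.

Lemma lebesgue_triadic n i : mu (triadic n i) = (3^-1 ^+ n)%:E.
Proof.
have T0 : 0 < (3^-1 ^+ n : R) by rewrite exprn_gt0.
rewrite triadicE lebesgue_measure_itv/= lte_fin -!exprVn ltr_pM2r// ltrDl ltr01.
by rewrite -EFinB; congr EFin; ring.
Qed.

Lemma triadic_floor n x : triadic n (Num.floor (3 ^+ n * x)) x.
Proof. by have := floor_itv (3 ^+ n * x); rewrite intrD /triadic/= => /andP[-> /ltW]. Qed.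

Lemma triadic_dist n i x y : triadic n i x -> triadic n i y -> `|x - y| <= 3^-1 ^+ n.
Proof.
have T0 : 0 < (3 ^+ n : R) by rewrite exprn_gt0.
rewrite /triadic/= => /andP[? ?] /andP[? ?].
rewrite exprVn -(ler_pM2l T0) mulfV ?gt_eqF// -{1}(gtr0_norm T0) -normrM.
by rewrite ler_norml mulrBr; apply/andP; split; lra.
Qed.

Lemma triadic_neighbour n x y : `|x - y| <= 3^-1 ^+ n ->
  let i := Num.floor (3 ^+ n * x) in
  [\/ triadic n (i - 1) y, triadic n i y | triadic n (i + 1) y].
Proof.
have T0 : 0 < (3 ^+ n : R) by rewrite exprn_gt0.
rewrite exprVn -(ler_pM2l T0) mulfV ?gt_eqF// -{1}(gtr0_norm T0) -normrM.
rewrite ler_norml mulrBr => /andP[? ?] /=.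
have := triadic_floor n x; set i := Num.floor _; rewrite /triadic/= intrB intrD.
move=> /andP[? ?].
have [h|h] := ltP (3 ^+ n * y) i%:~R.
  by constructor 1; apply/andP; split; lra.
have [h'|h'] := leP (3 ^+ n * y) (i%:~R + 1); first by constructor 2.
by constructor 3; apply/andP; split; lra.
Qed.

Lemma osc_triadic_dist w n i x y : unbounded_depth w ->
  triadic n i x -> triadic n i y -> `|osc w x - osc w y| <= 3^-1 ^+ depth w n.
Proof.
move=> wu xi yi; have [k [Hk _]] := osc_triadic (R := R) n i wu.
have P0 : 0 < (3 ^+ depth w n : R) by rewrite exprn_gt0.
have /andP[? ?] := Hk _ xi; have /andP[? ?] := Hk _ yi.
rewrite exprVn -(ler_pM2l P0) mulfV ?gt_eqF// -{1}(gtr0_norm P0) -normrM.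
by rewrite ler_norml mulrBr; apply/andP; split; lra.
Qed.

(** Points of adjacent triadic intervals are compared through the common end. *)
Lemma osc_dist w n x y : unbounded_depth w -> `|x - y| <= 3^-1 ^+ n ->
  `|osc w x - osc w y| <= 2 * 3^-1 ^+ depth w n.
Proof.
move=> wu /triadic_neighbour/=; have := triadic_floor n x; set i := Num.floor _ => xi.
have d0 : 0 <= 3^-1 ^+ depth w n :> R by rewrite exprn_ge0.
have T0 : 3 ^+ n != 0 :> R by rewrite expf_neq0.
have common (z : R) (j j' : int) : triadic n j x -> triadic n j z -> triadic n j' z ->
    triadic n j' y -> `|osc w x - osc w y| <= 2 * 3^-1 ^+ depth w n.
  move=> xj zj zj' yj'; apply: (le_trans (ler_distD (osc w z) _ _)).
  by rewrite mulr_natl mulr2n lerD//; apply: osc_triadic_dist; eauto.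
have zE z : 3 ^+ n * (z / 3 ^+ n) = z :> R by rewrite mulrC divfK.
case=> yi.
- apply: (common (i%:~R / 3 ^+ n) i (i - 1)) => //; rewrite /triadic/= zE ?intrB; lra.
- by apply: (common x i i).
- apply: (common ((i%:~R + 1) / 3 ^+ n) i (i + 1)) => //;
    rewrite /triadic/= zE ?intrD; lra.
Qed.

Lemma osc_continuous w : unbounded_depth w -> continuous (osc w : R -> R).
Proof.
move=> wu x; apply/cvgrPdist_le => e e0.
have [n /(_ n (leqnn n)) ne] := depth_small (R := R) wu (divr_gt0 e0 (ltr0Sn R 1)).
have T0 : 0 < (3^-1 ^+ n : R) by rewrite exprn_gt0.
near=> y; apply: (le_trans (osc_dist (n := n) wu _)).
  near: y; apply/nbhs_normP; exists (3^-1 ^+ n) => //= y /ltW.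
  by [].
by rewrite mulrC -ler_pdivlMr.
Unshelve. all: by end_near. Qed.

Lemma triadic_scale y : 0 < y <= 1 -> exists n, 3^-1 ^+ n.+1 < y <= 3^-1 ^+ n.
Proof.
move=> /andP[y0 y1].
have ex : exists n, 3^-1 ^+ n.+1 < y.
  exists (Num.truncn y^-1).+1.
  rewrite exprVn -[ltRHS]invrK ltf_pV2 ?posrE ?invr_gt0 ?exprn_gt0//.
  apply: (lt_trans (truncnS_gt _)); rewrite -natrX ltr_nat.
  by rewrite (ltn_trans (ltn_expl _ (isT : 1 < 3)%N))// ltn_exp2l.
case: (ex_minnP ex) => n ny nmin; exists n; rewrite ny/=.
case: n ny nmin => [|n] _ nmin; first by rewrite expr0.
by rewrite leNgt; apply/negP => /nmin; rewrite ltnn.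
Qed.

Lemma powR3 n : 3^-1 ^+ n = 3 `^ (- n%:R) :> R.
Proof. by rewrite powRN powR_mulrn// exprVn. Qed.

(** A set of diameter [d] with [3^-(n+1) < d <= 3^-n] sees at most three triadic
    intervals of generation [n], and in each of them a range of values of length
    [2 * d].  The total length is at most a multiple of [3^depth * d^2], and
    [3^depth] is at most a multiple of [d^-t]. *)
Lemma osc_mass_le w t K s (U : set (R * R)) : unbounded_depth w ->
  0 <= s -> s <= 2 - t -> 0 <= t ->
  (forall n, (depth w n)%:R <= t * n%:R + K) ->
  (diam U <= 1%:E)%E -> exists W, [/\ measurable W,
    forall x, U (x, osc w x) -> W x &
    (mu W <= (27 * 3 `^ K)%:E * diam_pow s U)%E].
Proof.
move=> wu s0 st t0 wK U1; have [->|/set0P U0] := eqVneq U set0.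
  by exists set0; split=> //; rewrite measure0 mule_ge0 ?diam_pow_ge0// lee_fin
    mulr_ge0 ?powR_ge0.
have [d /andP[d0 d1] [dE ->]] := diam_pow_fin s U0 U1.
have [p Up] := U0.
have Ud x : U (x, osc w x) -> `|p.1 - x| <= d /\ `|p.2 - osc w x| <= d.
  move=> Ux; have pd : edist p (x, osc w x) <= d.
    by rewrite -lee_fin -dE edist_le_diam.
  split; first exact: le_trans (edist_fst p (x, osc w x)) pd.
  exact: le_trans (edist_snd p (x, osc w x)) pd.
have [dz|dN0] := eqVneq d 0.
  exists `[p.1, p.1]%classic; split; first exact: measurable_itv.
    move=> x /Ud[+ _]; rewrite dz normr_le0 subr_eq0 => /eqP <-.
    by rewrite /= in_itv/= lexx.
  by rewrite lebesgue_measure_itv/= ltxx lee_fin !mulr_ge0 ?powR_ge0.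
have {dN0} d0 : 0 < d by rewrite lt_neqAle eq_sym dN0.
have [|n /andP[nd dn]] := triadic_scale (y := d); first by rewrite d0.
have T0 : 0 < (3^-1 ^+ n : R) by rewrite exprn_gt0.
pose P : R := 3 ^+ depth w n; have P0 : 0 < P by rewrite exprn_gt0.
pose e := P * d * 3^-1 ^+ n; have e0 : 0 < e by rewrite !mulr_gt0.
have pd : p.2 - d <= p.2 + d by lra.
have cov j : covered [set x | triadic n j x /\ p.2 - d <= osc w x <= p.2 + d] (3 * e).
  have [k [_ Hc]] := osc_triadic (R := R) n j wu.
  apply: covered_sub (Hc _ _ e pd e0) => //; rewrite -/P /e exprVn.
  by rewrite le_eqVlt; apply/orP; left; apply/eqP; ring.
pose i := Num.floor (3 ^+ n * p.1).
have [W [mW AW muW]] :=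
  covered_measurable (coveredU (coveredU (cov (i - 1)) (cov i)) (cov (i + 1))).
exists W; split=> //.
  move=> x /Ud[px1 px2]; apply: AW.
  have xo : p.2 - d <= osc w x <= p.2 + d by rewrite -ler_distl distrC.
  have := triadic_neighbour (le_trans px1 dn); rewrite -/i.
  by case=> xi; [left; left|left; right|right].
apply: (le_trans muW); rewrite lee_fin.
have -> : 3 * e + 3 * e + 3 * e = 9 * (P * (d * 3^-1 ^+ n)) by rewrite /e; ring.
have PK : P <= 3 `^ K * d `^ (- t).
  apply: (@le_trans _ _ (3 `^ (t * n%:R + K))).
    by rewrite /P -powR_mulrn// ler_powR// ler1n.
  rewrite addrC powRD; last by rewrite pnatr_eq0 implybT.
  rewrite ler_wpM2l ?powR_ge0// powRN.
  have -> : 3 `^ (t * n%:R) = ((3^-1 ^+ n) `^ t)^-1 :> R.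
    by rewrite powR3 -powRrM -powRN mulNr opprK mulrC.
  rewrite lef_pV2 ?posrE ?powR_gt0//.
  by rewrite ge0_ler_powR ?nnegrE ?(ltW d0) ?(ltW T0).
have dd : d * 3^-1 ^+ n <= 3 * (d * d).
  by move: nd; rewrite exprS => nd; rewrite mulrCA ler_pM2l//; lra.
apply: (@le_trans _ _ (9 * (3 `^ K * d `^ (- t) * (3 * (d * d))))).
  by rewrite ler_pM2l// ler_pM ?(ltW P0)// mulr_ge0 ?(ltW d0) ?(ltW T0).
have -> : 9 * (3 `^ K * d `^ (- t) * (3 * (d * d))) =
  27 * 3 `^ K * (d `^ (- t) * d ^+ 2) by ring.
rewrite ler_pM2l ?mulr_gt0 ?powR_gt0// -powR_mulrn ?(ltW d0)//.
rewrite -powRD; last by rewrite (gt_eqF d0) implybT.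
by apply: ger_powR; [rewrite d0|lra].
Qed.

(** Take the triadic interval around [x] of length [q], the largest power of 1/3
    below [r / 2].  Its values lie in an interval of length [1 / P], with [P] the
    power of 3 given by the depth, and a subinterval of length [q] around [osc w x]
    stays within the disc.  The values below and above that subinterval are taken
    on sets of measure at most [P * q] times the lengths of their ranges, up to [e].
    What remains has measure at least [P * q * q - 2 * e], and the two errors [e]
    cost half of it. *)
Lemma osc_mass_ge w t x r : unbounded_depth w ->
  0 <= t <= 1 -> (forall n, t * n%:R - 1 <= (depth w n)%:R) ->
  0 <= x <= 1 -> 0 < r <= 1 ->
  exists A : set R, [/\ measurable A, A `<=` `[-1, 2],
    forall y, A y -> ecball (x, osc w x) r (y, osc w y) &
    (((6 * 6 `^ (2 - t))^-1 * r `^ (2 - t))%:E <= mu A)%E].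
Proof.
move=> wu /andP[t0 t1] wt /andP[x0 x1] /andP[r0 r1].
have [|n /andP[nr rn]] := triadic_scale (y := r / 2); first by lra.
set m := n.+1 in nr; pose q : R := 3^-1 ^+ m.
have q0 : 0 < q by rewrite exprn_gt0.
have r6 : r <= 6 * q.
  by move: rn; rewrite /q /m exprS; set z := 3^-1 ^+ n; lra.
rewrite -/q in nr; have q1 : q <= 1 by lra.
pose i := Num.floor (3 ^+ m * x).
have xi : triadic m i x by exact: triadic_floor.
have [k [Hk Hc]] := osc_triadic (R := R) m i wu.
pose P : R := 3 ^+ depth w m; have P0 : 0 < P by rewrite exprn_gt0.
rewrite -/P in Hk Hc.
have Pq : P * q <= 1.
  rewrite /P /q exprVn ler_pdivrMr ?exprn_gt0// mul1r.
  by rewrite ler_weXn2l// ?ler1n// depth_le.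
(* The range of values starts at [osc w x], or lower if it would overflow. *)
pose v := Num.min (osc w x) ((k%:~R + 1) / P - q).
have /andP[kx xk] := Hk _ xi.
have Pdiv (z : R) : P * (z / P) = z by rewrite mulrC divfK ?gt_eqF.
have v1 : P * v <= k%:~R + 1 - P * q.
  rewrite -[leRHS](_ : P * ((k%:~R + 1) / P - q) = _); last by rewrite mulrBr Pdiv.
  by rewrite ler_pM2l// /v ge_min lexx orbT.
have v2 : k%:~R <= P * v.
  rewrite /v; have [_|_] := leP (osc w x) ((k%:~R + 1) / P - q); first exact: kx.
  by rewrite mulrBr Pdiv; lra.
have vx : v <= osc w x <= v + q.
  rewrite /v; have [h|h] := leP (osc w x) ((k%:~R + 1) / P - q).
    by rewrite lexx lerDl ltW.
  rewrite ltW//= subrK -(ler_pM2l P0) Pdiv//.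
pose e := P * q * q / 4; have e0 : 0 < e by rewrite divr_gt0// !mulr_gt0.
have ab1 : k%:~R / P <= v by rewrite -(ler_pM2l P0) Pdiv.
have ab2 : v + q <= (k%:~R + 1) / P.
  by rewrite -(ler_pM2l P0) Pdiv mulrDr; lra.
have [W1 [mW1 AW1 muW1]] := covered_measurable (Hc _ _ e ab1 e0).
have [W2 [mW2 AW2 muW2]] := covered_measurable (Hc _ _ e ab2 e0).
have mtriadic : measurable (triadic m i : set R).
  by rewrite triadicE; exact: measurable_itv.
have mA : measurable (triadic m i `\` (W1 `|` W2)).
  by apply: measurableD => //; exact: measurableU.
have Aosc y : (triadic m i `\` (W1 `|` W2)) y -> v <= osc w y <= v + q.
  move=> [yi /not_orP[yW1 yW2]]; have /andP[ky yk] := Hk _ yi.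
  apply/andP; split.
    rewrite leNgt; apply/negP => yv; apply: yW1; apply: AW1; split=> //.
    apply/andP; split; last exact: ltW.
    by rewrite -(ler_pM2l P0) Pdiv.
  rewrite leNgt; apply/negP => yv; apply: yW2; apply: AW2; split=> //.
  apply/andP; split; first exact: ltW.
  by rewrite -(ler_pM2l P0) Pdiv.
exists (triadic m i `\` (W1 `|` W2)); split=> //.
- move=> y [yi _]; have := triadic_dist xi yi; rewrite -/q ler_distl => /andP[? ?].
  by rewrite /= in_itv/=; apply/andP; split; lra.
- move=> y yA; rewrite /ecball/=; apply: (le_trans (edist_leD _ _)) => /=.
  have := triadic_dist xi yA.1; rewrite -/q => xy.
  have : `|osc w x - osc w y| <= q.
    by move: vx (Aosc y yA) => /andP[? ?] /andP[? ?]; rewrite ler_norml; lra.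
  lra.
have muA : ((P * q * q / 2)%:E <= mu (triadic m i `\` (W1 `|` W2)))%E.
  have : (mu (triadic m i) <=
      mu (triadic m i `\` (W1 `|` W2)) + (mu W1 + mu W2))%E.
    apply: (@le_trans _ _ (mu ((triadic m i `\` (W1 `|` W2)) `|` (W1 `|` W2)))).
      apply: le_measure; rewrite ?inE//; first by do ?apply: measurableU.
      by move=> y yi; have [|] := pselect ((W1 `|` W2) y); [right|left].
    apply: (le_trans (measureU2 mu mA (measurableU _ _ mW1 mW2))).
    by rewrite leeD2l//; exact: (measureU2 mu mW1 mW2).
  rewrite lebesgue_triadic -/q.
  have := measure_ge0 mu (triadic m i `\` (W1 `|` W2)).
  case: (mu (triadic m i `\` (W1 `|` W2))) => [z| |]//=; last by rewrite leey.
  move=> z0; move=> /le_trans/(_ (leeD2l _ (leeD muW1 muW2))).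
  rewrite -!EFinD !lee_fin.
  have -> : P * (v - k%:~R / P) / 3 ^+ m + e +
      (P * ((k%:~R + 1) / P - (v + q)) / 3 ^+ m + e) =
    q * (P * (k%:~R / P + P^-1 - k%:~R / P)) - P * q * q + 2 * e.
    by rewrite -exprVn -/q; ring.
  have -> : k%:~R / P + P^-1 - k%:~R / P = P^-1 by ring.
  rewrite mulfV ?gt_eqF// mulr1 /e; lra.
apply: (le_trans _ muA); rewrite lee_fin.
have s0 : 0 <= 2 - t by lra.
have : r `^ (2 - t) <= 6 `^ (2 - t) * (3 * (P * q * q)).
  apply: (@le_trans _ _ ((6 * q) `^ (2 - t))).
    by rewrite ge0_ler_powR ?nnegrE ?mulr_ge0 ?(ltW q0) ?(ltW r0).
  rewrite powRM ?(ltW q0)// ler_wpM2l ?powR_ge0//.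
  have -> : 3 * (P * q * q) = 3 `^ (1 + (depth w m)%:R - 2 * m%:R).
    have -> : 1 + (depth w m)%:R - 2 * m%:R =
      1 + ((depth w m)%:R + (- m%:R + - m%:R)) :> R by ring.
    have r3 u v' : (u + v' == 0) ==> ((3 : R) != 0) by rewrite pnatr_eq0 implybT.
    by rewrite !powRD ?r3// powRr1// -powR3 -/q powR_mulrn// -/P !mulrA.
  rewrite /q powR3 -powRrM ler_powR ?ler1n//.
  have := wt m; lra.
move=> h; rewrite ler_pdivrMl ?mulr_gt0 ?powR_gt0//.
by apply: (le_trans h); lra.
Qed.

End OscGraphDim.

(** * Dimensions of oscillating and of Lipschitz graphs *)

Section OscDim.
Context {R : realType}.

Lemma hausdorff_dim_ge (F : set (R * R)) (b : R) :
  (forall s, 0 <= s -> s < b -> hausdorff_measure s F <> 0%E) ->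
  (b%:E <= hausdorff_dim F)%E.
Proof.
move=> HF; apply: le_ereal_inf_tmp => _ [s [s0 Fs] <-]; rewrite lee_fin leNgt.
by apply/negP => sb; exact: HF Fs.
Qed.

(** With [t = 2 - b], the depth is at least [t * n - 1], which gives the packing
    bound with exponent [b] itself, and at most [(t + e) * n] up to a constant for
    every [e > 0], which gives the Hausdorff bound with the exponents below [b]. *)
Lemma osc_graph_exists (b : R) : 1 <= b <= 2 -> exists h : R -> R,
  [/\ continuous h,
    forall u v, u < v -> (b%:E <= hausdorff_dim (graph_on h `[u, v]))%E &
    (packing_dim (graph_on h `[0%R, 1%R]) <= b%:E)%E].
Proof.
move=> /andP[b1 b2]; pose t := 2 - b; have t01 : 0 <= t <= 1 by rewrite /t; lra.
pose w := climb_word t.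
have wu : unbounded_depth w.
  move=> q; exists (q ^ 2 + 2)%N; rewrite depth_climb.
  have := climb_sqr t (q ^ 2 + 2); move: (climb _ _) => c.
  by case: (leqP q c) => // cq; nia.
exists (osc w); split; first exact: osc_continuous.
- move=> u v uv; apply: hausdorff_dim_ge => s s0 sb.
  have e0 : 0 < b - s by rewrite subr_gt0.
  have [t0 t1] := andP t01.
  apply: (@hausdorff_measure_graph_neq0 _ _ _ _ _
    (27 * 3 `^ ((b - s)^-1 + 1))) => //.
  move=> U U1.
  have st : s <= 2 - (t + (b - s)) by rewrite /t; lra.
  have ts0 : 0 <= t + (b - s) by lra.
  have wle n : (depth w n)%:R <= (t + (b - s)) * n%:R + ((b - s)^-1 + 1).
    by rewrite depth_climb; exact: climb_le.
  have [W [mW UW muW]] := osc_mass_le wu s0 st ts0 wle U1.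
  by exists W; split=> // x _; exact: UW.
- apply: (@packing_dim_graph_le _ _ _ _ (-1) 2 (6 * 6 `^ (2 - t))^-1).
  + by lra.
  + by rewrite invr_gt0 mulr_gt0// powR_gt0.
  + by lra.
  move=> x r /=; rewrite in_itv/= => x01 r01.
  have -> : b = 2 - t by rewrite /t; ring.
  apply: osc_mass_ge => // n; rewrite depth_climb; exact: climb_ge.
Qed.

(** A disc of radius [r] around a point of the graph contains the graph over an
    interval of length [c * r] on one side of that point, the one with more room. *)
Lemma packing_dim_lipschitz (g : R -> R) (p q L : R) : p < q -> 0 <= L ->
  (forall x y, p <= x <= q -> p <= y <= q -> `|g x - g y| <= L * `|x - y|) ->
  (packing_dim (graph_on g `[p, q]) <= 1%:E)%E.
Proof.
move=> pq L0 gL; pose c := Num.min (1 + L)^-1 ((q - p) / 2).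
have c0 : 0 < c by rewrite lt_min invr_gt0 divr_gt0 ?subr_gt0// ltr_pwDl.
have cL : c * (1 + L) <= 1 by rewrite -ler_pdivlMr ?ltr_pwDl// mul1r ge_min lexx.
have cpq : c <= (q - p) / 2 by rewrite ge_min lexx orbT.
apply: (@packing_dim_graph_le _ _ _ _ p q c) => // x r /=.
rewrite in_itv/= => /andP[px xq] /andP[r0 r1].
have cr : c * r <= c by rewrite ger_pMr.
have cr0 : 0 < c * r by rewrite mulr_gt0.
have [a [pa aq ax xa]] : exists a, [/\ p <= a, a + c * r <= q, a <= x &
    x <= a + c * r].
  have [h|h] := leP x ((p + q) / 2); first by exists x; split; lra.
  by exists (x - c * r); split; lra.
exists `[a, a + c * r]%classic; split; first exact: measurable_itv.
- by move=> y /=; rewrite !in_itv/= => /andP[? ?]; apply/andP; split; lra.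
- move=> y /=; rewrite in_itv/= => /andP[ay ya].
  rewrite /ecball/=; apply: (le_trans (edist_leD _ _)) => /=.
  have xy : `|x - y| <= c * r by rewrite ler_norml; lra.
  have := gL x y; rewrite px xq/= => /(_ isT) gxy.
  have {}gxy : `|g x - g y| <= L * `|x - y| by apply: gxy; lra.
  apply: (@le_trans _ _ ((1 + L) * (c * r))).
    by rewrite mulrDl mul1r lerD// (le_trans gxy)// ler_wpM2l.
  by rewrite mulrA (mulrC _ c) ger_pMl.
- rewrite lebesgue_measure_itv/= lte_fin ltrDl cr0 -EFinB lee_fin powRr1 ?(ltW r0)//.
  by lra.
Qed.

End OscDim.

(** * Linear interpolation across gaps *)

Section Interpolation.
Context {R : realType}.
Implicit Types (x y l u e d : R).

Lemma within_continuousP (A : set R) (f : R -> R) :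
  {within A, continuous f} <->
  forall x, A x -> forall e, 0 < e ->
    exists2 d, 0 < d & forall y, A y -> `|x - y| < d -> `|f x - f y| <= e.
Proof.
split=> [/subspace_continuousP cf x Ax e e0|cf].
  have /cvgrPdist_le/(_ e e0) := cf x Ax.
  rewrite near_withinE => /nbhs_normP[d /= d0 dP]; exists d => // y Ay xy.
  exact: dP.
apply/subspace_continuousP => x Ax; apply/cvgrPdist_le => e e0.
have [d d0 dP] := cf x Ax e e0.
by rewrite near_withinE; apply/nbhs_normP; exists d => //= y xy Ay; exact: dP.
Qed.

Variables (Y : set R) (f : R -> R).
Hypotheses (Y_compact : compact Y) (f_cont : {within Y, continuous f}).
Hypotheses (Y0 : Y 0) (Y1 : Y 1).

Definition is_gap l u := [/\ Y l, Y u & forall y, l < y < u -> ~ Y y].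

Lemma gap_exists x : 0 <= x <= 1 -> ~ Y x ->
  exists lu : R * R, is_gap lu.1 lu.2 /\ lu.1 < x < lu.2.
Proof.
move=> /andP[x0 x1] Yx.
have far z : ~ Y z -> exists2 d, 0 < d & forall y, `|z - y| < d -> ~ Y y.
  move=> Yz; have : open (~` Y) by rewrite openC; exact: compact_closed.
  by rewrite openE => /(_ z Yz) /nbhs_normP[d /= d0 dY]; exists d.
pose A := Y `&` [set y | y <= x]; pose B := Y `&` [set y | x <= y].
have supA : has_sup A by split; [exists 0|exists x => y []].
have infB : has_inf B by split; [exists 1|exists x => y []].
have Ysup : Y (sup A).
  apply: contrapT => /far[d d0 dY]; have [y [Yy yx] ly] := sup_adherent d0 supA.
  apply: (dY y) => //; have ys : y <= sup A by apply: ub_le_sup => //; case: supA.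
  by rewrite ger0_norm ?subr_ge0// ltrBlDr -ltrBlDl; lra.
have Yinf : Y (inf B).
  apply: contrapT => /far[d d0 dY]; have [y [Yy xy] yu] := inf_adherent d0 infB.
  apply: (dY y) => //; have ys : inf B <= y by apply: ge_inf => //; case: infB.
  by rewrite ler0_norm ?subr_le0// opprB ltrBlDl.
have lx : sup A < x.
  rewrite lt_neqAle; apply/andP; split; first by apply/eqP => E; apply: Yx; rewrite -E.
  by apply: ge_sup; [case: supA|move=> y []].
have xu : x < inf B.
  rewrite lt_neqAle; apply/andP; split; first by apply/eqP => E; apply: Yx; rewrite E.
  by apply: lb_le_inf; [case: infB|move=> y []].
exists (sup A, inf B); rewrite /= lx xu; split=> //; split=> // y /andP[ly yu] Yy.
have [yx|/ltW xy] := leP y x.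
  by move: ly; rewrite ltNge => /negP; apply; apply: ub_le_sup; [case: supA|].
by move: yu; rewrite ltNge => /negP; apply; apply: ge_inf; [case: infB|].
Qed.

Lemma gap_unique l u l' u' x : is_gap l u -> is_gap l' u' ->
  l < x < u -> l' < x < u' -> l = l' /\ u = u'.
Proof.
move=> [Yl Yu lu] [Yl' Yu' lu'] /andP[lx xu] /andP[lx' xu']; split.
- apply/eqP; case: ltgtP => // h.
    by case: (lu l') => //; rewrite h (lt_trans lx').
  by case: (lu' l) => //; rewrite h (lt_trans lx).
- apply/eqP; case: ltgtP => // h.
    by case: (lu' u) => //; rewrite h (lt_trans lx').
  by case: (lu u') => //; rewrite h (lt_trans lx).
Qed.

Definition gap_of x : R * R := xget (0, 1) [set lu | is_gap lu.1 lu.2 /\ lu.1 < x < lu.2].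

(** On a gap this is affine, by [interp_gap]; the default pair in [gap_of] is
    never used between the extreme points of [Y]. *)
Definition interp x : R :=
  if `[< Y x >] then f x else
  let: (l, u) := gap_of x in f l + (x - l) / (u - l) * (f u - f l).

Lemma interp_in x : Y x -> interp x = f x.
Proof. by move=> Yx; rewrite /interp asboolT. Qed.

Lemma interp_gap l u x : is_gap l u -> l < x < u ->
  interp x = f l + (x - l) / (u - l) * (f u - f l).
Proof.
move=> lu lxu; have [Yl Yu nY] := lu.
rewrite /interp asboolF; last exact: nY.
have : exists lu' : R * R, is_gap lu'.1 lu'.2 /\ lu'.1 < x < lu'.2 by exists (l, u).
move=> /(xgetPex (0, 1)); rewrite -/(gap_of x).
case: (gap_of x) => l' u' /= [lu' lxu'].
by have [-> ->] := gap_unique lu lu' lxu lxu'.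
Qed.

Lemma interp_gap_lipschitz l u p q : is_gap l u -> l < p -> q < u ->
  forall x y, p <= x <= q -> p <= y <= q ->
  `|interp x - interp y| <= (`|f u - f l| / (u - l)) * `|x - y|.
Proof.
move=> lu lp qu x y /andP[px xq] /andP[py yq].
have ul : 0 < u - l by lra.
rewrite !(interp_gap lu); try by apply/andP; split; lra.
set D := f u - f l.
have -> : f l + (x - l) / (u - l) * D - (f l + (y - l) / (u - l) * D) =
  (D / (u - l)) * (x - y) by ring.
by rewrite !normrM normfV (gtr0_norm ul).
Qed.

Lemma interp_lipschitz p q : 0 <= p -> p < q -> q <= 1 ->
  (forall y, p <= y <= q -> ~ Y y) ->
  exists2 L, 0 <= L & forall x y, p <= x <= q -> p <= y <= q ->
  `|interp x - interp y| <= L * `|x - y|.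
Proof.
move=> p0 pq q1 pqY.
have [||[l u] /= [lu /andP[lp pu]]] := @gap_exists p.
- by rewrite p0 ltW// (lt_le_trans pq).
- by apply: pqY; rewrite lexx ltW.
exists (`|f u - f l| / (u - l)).
  by rewrite divr_ge0// subr_ge0 ltW// (lt_trans lp).
apply: interp_gap_lipschitz => //; rewrite ltNge; apply/negP => uq.
by case: lu => _ Yu _; apply: (pqY u) => //; rewrite uq ltW.
Qed.

(** At a point [x] of a gap near [x0], let [c] be the end of the gap towards [x0] and
    [c'] the other one.  Either [c'] is close to [x0] too and both values of [f] are
    close to [f x0], or the gap is long compared with the distance from [x] to [c],
    and the interpolation has hardly moved away from [f c]. *)
Lemma interp_near_endpoint x0 M e d c c' x : Y x0 -> 0 < e -> 0 < d ->
  (forall y, Y y -> `|f y| <= M) ->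
  (forall y, Y y -> `|x0 - y| < d -> `|f x0 - f y| <= e) ->
  Y c -> Y c' -> `|x0 - c| <= `|x0 - x| -> `|x - c| <= `|x0 - x| ->
  `|x - c| <= `|c' - c| -> `|x0 - x| < d / 2 -> `|x0 - x| * (4 * M) <= d * e ->
  `|x0 - c'| - `|x0 - x| <= `|c' - c| -> 0 < `|c' - c| ->
  interp x - f c = `|x - c| / `|c' - c| * (f c' - f c) ->
  `|f x0 - interp x| <= 3 * e.
Proof.
move=> Yx0 e0 d0 fM fd Yc Yc' xc1 xc2 xc3 xd xM h2 cc0 E.
have fc : `|f x0 - f c| <= e by apply: fd => //; apply: (le_lt_trans xc1); lra.
suff : `|interp x - f c| <= 2 * e.
  move=> h; have -> : f x0 - interp x = (f x0 - f c) - (interp x - f c) by ring.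
  by apply: (le_trans (ler_normB _ _)); lra.
rewrite E !normrM normrV ?unitf_gt0// !normr_id.
have [cd|dc] := ltP `|x0 - c'| d.
  have fc' := fd c' Yc' cd.
  apply: (@le_trans _ _ (1 * `|f c' - f c|)).
    by rewrite ler_wpM2r// ler_pdivrMr// mul1r.
  have -> : f c' - f c = (f x0 - f c) - (f x0 - f c') by ring.
  by rewrite mul1r (le_trans (ler_normB _ _))//; lra.
have M2 : `|f c' - f c| <= 2 * M.
  by apply: (le_trans (ler_normB _ _)); have := fM c Yc; have := fM c' Yc'; lra.
have dcc : d / 2 <= `|c' - c| by lra.
rewrite mulrAC ler_pdivrMr//.
apply: (@le_trans _ _ (`|x0 - x| * (2 * M))); first by rewrite ler_pM.
apply: (@le_trans _ _ (d * e / 2)); first by lra.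
have -> : d * e / 2 = e * (d / 2) by ring.
by apply: (@le_trans _ _ (e * `|c' - c|)); [rewrite ler_pM2l|rewrite ler_pM2r//; lra].
Qed.

Lemma interp_continuous : {within `[0, 1], continuous interp}.
Proof.
have [M M0 fM] : exists2 M, 0 < M & forall y, Y y -> `|f y| <= M.
  have : compact (f @` Y) by apply: continuous_compact.
  move=> /compact_bounded/ex_strict_bound_gt0[M M0 fM]; exists M => // y Yy.
  by apply/ltW/fM; exists y.
apply/within_continuousP => x0 /=; rewrite in_itv/= => x001 e e0.
have [Yx0|nYx0] := pselect (Y x0); last first.
  have [[l u] /= [lu /andP[lx xu]]] := gap_exists x001 nYx0.
  (* Halfway to the ends, so that the closed interval lies within the gap. *)
  pose p := (l + x0) / 2; pose q := (x0 + u) / 2.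
  have ul : 0 < u - l by lra.
  have lip := @interp_gap_lipschitz l u p q lu _ _.
  pose L := `|f u - f l| / (u - l).
  have L0 : 0 <= L by rewrite divr_ge0// ltW.
  exists (Num.min (e / (1 + L)) (Num.min (x0 - p) (q - x0))).
    have px : 0 < x0 - p by rewrite /p; lra.
    have qx : 0 < q - x0 by rewrite /q; lra.
    by rewrite !lt_min px qx !andbT divr_gt0// ltr_pwDl.
  move=> y _; rewrite !lt_min => /and3P[ye yp yq].
  apply: (le_trans (lip _ _ x0 y _ _)); rewrite -/L.
  - by rewrite /p; lra.
  - by rewrite /q; lra.
  - by rewrite /p /q; apply/andP; split; lra.
  - by move: yp yq; rewrite !ltr_norml => /andP[? ?] /andP[? ?]; apply/andP; split; lra.
  apply: (@le_trans _ _ ((1 + L) * `|x0 - y|)).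
    by rewrite ler_wpM2r// lerDr.
  by rewrite mulrC -ler_pdivlMr ?ltr_pwDl// ltW.
have e3 : 0 < e / 3 by rewrite divr_gt0.
have [d d0 fd] := (within_continuousP Y f).1 f_cont x0 Yx0 _ e3.
exists (Num.min (d / 2) (d * (e / 3) / (4 * M))).
  by rewrite lt_min !divr_gt0 ?mulr_gt0.
move=> x /=; rewrite in_itv/= lt_min => x01 /andP[xd].
rewrite ltr_pdivlMr ?mulr_gt0// => /ltW xM.
have -> : e = 3 * (e / 3) by field.
rewrite (interp_in Yx0).
have [Yx|nYx] := pselect (Y x).
  rewrite interp_in//; apply: (le_trans (fd _ Yx _)); last by lra.
  by apply: (lt_trans xd); lra.
have [[l u] /= [lu lxu]] := gap_exists x01 nYx.
have [Yl Yu nY] := lu; have /andP[lx xu] := lxu.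
have xE := interp_gap lu lxu.
have ul : u - l != 0 by rewrite gt_eqF//; lra.
have [xl|lx0] := leP x0 l.
  have e1 : `|x0 - l| = l - x0 by rewrite ler0_norm; lra.
  have e2 : `|x0 - x| = x - x0 by rewrite ler0_norm; lra.
  have e6 : `|x - l| = x - l by rewrite ger0_norm; lra.
  have e4 : `|u - l| = u - l by rewrite ger0_norm; lra.
  have e5 : `|x0 - u| = u - x0 by rewrite ler0_norm; lra.
  apply: (interp_near_endpoint (d := d) (M := M) (c := l) (c' := u)) => //;
    rewrite ?e1 ?e6 ?e4 ?e5 ?e2; try lra.
have ux : u <= x0 by rewrite leNgt; apply/negP => x0u; apply: (nY x0) => //; rewrite lx0.
have e1 : `|x0 - u| = x0 - u by rewrite ger0_norm; lra.
have e2 : `|x0 - x| = x0 - x by rewrite ger0_norm; lra.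
have e6 : `|x - u| = u - x by rewrite ler0_norm; lra.
have e4 : `|l - u| = u - l by rewrite ler0_norm; lra.
have e5 : `|x0 - l| = x0 - l by rewrite ger0_norm; lra.
apply: (interp_near_endpoint (d := d) (M := M) (c := u) (c' := l)) => //;
  rewrite ?e1 ?e6 ?e4 ?e5 ?e2; try lra.
by rewrite xE; field.
Qed.

End Interpolation.

(** * Assembling the extension *)

Section Extension.
Context {R : realType}.
Implicit Types (X Y : set R) (f g h : R -> R).

Lemma eq_within_continuous X f g : (forall x, X x -> f x = g x) ->
  {within X, continuous f} -> {within X, continuous g}.
Proof.
move=> fg /within_continuousP cf; apply/within_continuousP => x Xx e e0.
have [d d0 dP] := cf x Xx e e0; exists d => // y Xy xy.
by rewrite -!fg//; exact: dP.
Qed.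

Lemma within_continuous_set1 (a : R) g : {within [set a], continuous g}.
Proof.
apply/within_continuousP => x -> e e0; exists 1 => // y -> _.
by rewrite subrr normr0 ltW.
Qed.

Lemma proper_closed_gap X : closed X -> X `<` `[0, 1]%classic ->
  exists a b, [/\ 0 <= a, a < b, b <= 1 & forall x, a <= x <= b -> ~ X x].
Proof.
move=> Xc [X01 /existsNP[y /not_implyP[+ Xy]]]; rewrite /= in_itv/= => /andP[y0 y1].
have : open (~` X) by rewrite openC.
rewrite openE => /(_ y Xy) /nbhs_normP[d /= d0 dX].
have [h|h] := leP y (1 / 2).
  exists y, (y + Num.min (d / 2) (1 / 2)).
  have m1 : Num.min (d / 2) (1 / 2) <= d / 2 by rewrite ge_min lexx.
  have m2 : Num.min (d / 2) (1 / 2) <= 1 / 2 by rewrite ge_min lexx orbT.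
  have m0 : 0 < Num.min (d / 2) (1 / 2) by rewrite lt_min !divr_gt0.
  split=> //; [by lra|by lra|move=> x /andP[yx xd]].
  by apply: dX => /=; rewrite ler0_norm; lra.
exists (y - Num.min (d / 2) (1 / 2)), y.
have m1 : Num.min (d / 2) (1 / 2) <= d / 2 by rewrite ge_min lexx.
have m2 : Num.min (d / 2) (1 / 2) <= 1 / 2 by rewrite ge_min lexx orbT.
have m0 : 0 < Num.min (d / 2) (1 / 2) by rewrite lt_min !divr_gt0.
split=> //; [by lra|by lra|move=> x /andP[yx xd]].
by apply: dX => /=; rewrite ger0_norm; lra.
Qed.

Lemma packing_dim_cst (c : R) : (packing_dim (graph_on (fun=> c) `[0%R, 1%R]) <= 1%:E)%E.
Proof.
apply: (@packing_dim_lipschitz _ _ 0 1 0) => // x y _ _.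
by rewrite subrr normr0 mul0r.
Qed.

(** Every point off [Y] lies in an interval with rational ends disjoint from [Y],
    and there are only countably many of these. *)
Lemma interp_graph_cover Y f : compact Y -> Y `<=` `[0, 1] -> Y 0 -> Y 1 ->
  exists E : nat -> set (R * R),
    graph_on (interp Y f) (`[0, 1] `\` Y) `<=` \bigcup_n E n /\
    forall n, (packing_dim (E n) <= 1%:E)%E.
Proof.
move=> Yc Y01 Y0 Y1.
pose good (pq : rat * rat) := [/\ 0 <= ratr pq.1 :> R, ratr pq.1 < ratr pq.2 :> R,
  ratr pq.2 <= 1 :> R & forall y : R, ratr pq.1 <= y <= ratr pq.2 -> ~ Y y].
pose E n := if unpickle n is Some pq then
    if `[< good pq >] then graph_on (interp Y f) `[ratr pq.1, ratr pq.2]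
    else graph_on (fun=> 0) `[0, 1]
  else graph_on (fun=> 0) `[0, 1].
exists E; split=> [_ [x [+ nYx] <-]|n].
  rewrite /= in_itv/= => x01.
  have [[l u] /= [[Yl Yu lu] /andP[lx xu]]] := gap_exists Yc Y0 Y1 x01 nYx.
  have /andP[l0 l1] : 0 <= l <= 1 by have := Y01 _ Yl; rewrite /= in_itv.
  have /andP[u0 u1] : 0 <= u <= 1 by have := Y01 _ Yu; rewrite /= in_itv.
  have [p] := rat_in_itvoo lx; rewrite in_itv/= => /andP[lp px].
  have [q] := rat_in_itvoo xu; rewrite in_itv/= => /andP[xq qu].
  exists (pickle (p, q)); [exact: I|rewrite /E pickleK].
  rewrite ifT; last first.
    apply/asboolP; split=> /=; [by lra|by lra|by lra|].
    by move=> y /andP[py yq]; apply: lu; apply/andP; split; lra.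
  by exists x => //=; rewrite in_itv/=; apply/andP; split; lra.
rewrite /E; case: unpickle => [[p q]|]; last exact: packing_dim_cst.
case: ifPn => [/asboolP[/= p0 pq q1 pqY]|_]; last exact: packing_dim_cst.
have [L L0 lip] := interp_lipschitz f Yc Y0 Y1 p0 pq q1 pqY.
exact: packing_dim_lipschitz lip.
Qed.

(** The closed interval [J] inside a gap of [X] carries the oscillating function.
    Adding [J] and the points 0 and 1 to [X], so that every remaining gap has
    two ends, reduces the extension to linear interpolation. *)
Lemma extension_exists X f (b : R) : X `<` `[0, 1]%classic -> compact X ->
  {within X, continuous f} -> 1 <= b <= 2 ->
  exists g, [/\ {within `[0, 1], continuous g}, forall x, X x -> g x = f x,
    (b%:E <= hausdorff_dim (graph_on g `[0%R, 1%R]))%E &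
    exists E : nat -> set (R * R),
      graph_on g `[0, 1] `<=` graph_on f X `|` \bigcup_n E n /\
      forall n, (packing_dim (E n) <= b%:E)%E].
Proof.
move=> X_proper X_compact f_cont b12.
have [h [h_cont h_ge h_le]] := osc_graph_exists b12.
have X_closed : closed X by exact: compact_closed.
have [u [v [u0 uv v1 uvX]]] := proper_closed_gap X_closed X_proper.
pose J : set R := `[u, v]%classic.
pose Y := X `|` J `|` ([set 0] `|` [set 1]).
pose k x := if `[< X x >] then f x else if `[< J x >] then h x else 0.
have kX x : X x -> k x = f x by move=> Xx; rewrite /k asboolT.
have kJ x : J x -> k x = h x.
  move=> Jx; rewrite /k asboolF ?asboolT// => Xx.
  by apply: (uvX x) => //; move: Jx; rewrite /J/= in_itv.
have J_closed : closed J by exact: itv_closed.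
have Y_closed : closed Y.
  by apply: closedU; apply: closedU => //; exact: closed_eq.
have X01 : X `<=` `[0, 1] by case: X_proper.
have Y01 : Y `<=` `[0, 1].
  move=> x [[/X01//|]|[->|->]]; rewrite /J /= !in_itv/= ?lexx ?ler01//.
  by move=> /andP[? ?]; apply/andP; split; lra.
have Y_compact : compact Y.
  by apply: (subclosed_compact Y_closed) Y01; exact: segment_compact.
have k_cont : {within Y, continuous k}.
  apply: withinU_continuous.
  - exact: closedU.
  - by apply: closedU; exact: closed_eq.
  - apply: withinU_continuous => //.
      by apply: eq_within_continuous f_cont => x /kX.
    apply: (@eq_within_continuous J h) => [x /kJ//|].
    exact: continuous_subspaceT.
  - by apply: withinU_continuous; try exact: closed_eq; exact: within_continuous_set1.
have Y0 : Y 0 by right; left.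
have Y1 : Y 1 by right; right.
have [E [E_cover E_le]] := interp_graph_cover k Y_compact Y01 Y0 Y1.
pose g := interp Y k.
have gX x : X x -> g x = f x.
  by move=> Xx; rewrite /g interp_in ?kX//; left; left.
have gJ x : J x -> g x = h x.
  by move=> Jx; rewrite /g interp_in ?kJ//; left; right.
exists g; split=> //.
- exact: interp_continuous.
- apply: (le_trans (h_ge _ _ uv)); apply: le_hausdorff_dim.
  move=> _ [x xJ <-]; exists x; last by rewrite gJ.
  by move: xJ; rewrite /= !in_itv/= => /andP[? ?]; apply/andP; split; lra.
(* The segments are listed after the oscillating piece; the points over 0 and 1,
   which are new when they are not in [X], lie on horizontal segments. *)
pose E' n := match n with
  | 0%N => graph_on h `[0, 1]
  | 1%N => graph_on (fun=> g 0) `[0, 1]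
  | 2%N => graph_on (fun=> g 1) `[0, 1]
  | m.+3 => E m
  end.
have b1 : (1%:E <= b%:E)%E by rewrite lee_fin; case/andP: b12.
exists E'; split; last first.
  move=> [|[|[|n]]] /=; first exact: h_le.
  - exact: le_trans (packing_dim_cst _) b1.
  - exact: le_trans (packing_dim_cst _) b1.
  - exact: le_trans (E_le n) b1.
move=> _ [x x01 <-]; have [Yx|nYx] := pselect (Y x); last first.
  have [|n _ En] := E_cover (x, g x); first by exists x.
  by right; exists n.+3.
have i0 : `[0%R, 1%R]%classic (0 : R) by rewrite /= in_itv/= lexx ler01.
have i1 : `[0%R, 1%R]%classic (1 : R) by rewrite /= in_itv/= lexx ler01.
case: Yx => [[Xx|Jx]|[->|->]].
- by left; exists x => //; rewrite gX.
- by right; exists 0%N => //; exists x => //; rewrite gJ.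
- by right; exists 1%N => //; exists 0.
- by right; exists 2%N => //; exists 1.
Qed.

End Extension.

Theorem theorem4p6 (R : realType) (X : set R) (f : R -> R)
    (X_proper : X `<` `[0, 1]%classic) (X_compact : compact X)
    (f_cont : {within X, continuous f}) :
  (forall beta : R,
     (maxe (hausdorff_dim (graph_on f X)) 1%:E <= beta%:E)%E -> beta <= 2 ->
     exists g : R -> R,
       [/\ {within `[0, 1]%classic, continuous g},
           (forall x, X x -> g x = f x) &
           hausdorff_dim (graph_on g `[0, 1]%classic) = beta%:E]) /\
  (forall beta : R,
     (maxe (packing_dim (graph_on f X)) 1%:E <= beta%:E)%E -> beta <= 2 ->
     exists g : R -> R,
       [/\ {within `[0, 1]%classic, continuous g},
           (forall x, X x -> g x = f x) &
           packing_dim (graph_on g `[0, 1]%classic) = beta%:E]).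
Proof.
have cover (F A : set (R * R)) E : F `<=` A `|` \bigcup_n E n ->
    F `<=` \bigcup_n (if n is m.+1 then E m else A).
  by move=> FAE x /FAE[Ax|[n _ En]]; [exists 0%N|exists n.+1].
split=> beta; rewrite ge_max lee_fin => /andP[Xb b1] b2.
  have [|g [g_cont gf g_ge [E [gE E_le]]]] :=
    extension_exists X_proper X_compact f_cont (b := beta); first by rewrite b1.
  exists g; split=> //; apply/eqP; rewrite eq_le g_ge andbT.
  apply: (hausdorff_dim_bigcup (cover _ _ _ gE)) => -[//|n].
  exact: le_trans (hausdorff_dim_le_packing_dim _) (E_le n).
have [|g [g_cont gf g_ge [E [gE E_le]]]] :=
  extension_exists X_proper X_compact f_cont (b := beta); first by rewrite b1.
exists g; split=> //; apply/eqP; rewrite eq_le; apply/andP; split.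
  by apply: (packing_dim_bigcup (cover _ _ _ gE)) => -[//|n]; exact: E_le.
exact: le_trans g_ge (hausdorff_dim_le_packing_dim _).
Qed.
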